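(* Let $M>1$, let $\alpha\ge 3$ be an integer, and let $F(z)=\sum_{k=0}^{\alpha-1}\bar z^kA_k(z)$ be a polyanalytic function of order $\alpha$ on $\mathbb{D}$, where each $A_k(z)=\sum_{n=0}^\infty a_{n,k}z^n$ is analytic on $\mathbb{D}$. Suppose that all non-zero coefficients $a_{n_1,k_1},a_{n_2,k_2}$ satisfy $\left|\arg\frac{a_{n_1,k_1}}{a_{n_2,k_2}}\right|\le\frac{\pi}{2}$ for all $k_1,k_2\in\{0,\ldots,\alpha-1\}$ and $n_1,n_2\in\{0,1,2,\ldots\}$ with $k_1\ne k_2$, $n_1\ne n_2$. If $|F(z)|\le M$ for all $z\in\mathbb{D}$ and $F(0)=\lambda_F(0)-1=0$, then $F$ is univalent in the disk $\mathbb{D}_{r_3}$ and $F(\mathbb{D}_{r_3})$ contains a schlicht disk $\mathbb{D}_{\sigma_3}$, where $r_3$ is the least positive root of the equation $$1+\sqrt{M^2-1}-\frac{\sqrt{M^2-1}}{(1-r)^3}\Big[r(2-r)(1-r)+1+r+r^{\alpha-1}\big((\alpha-2)r-\alpha\big)\Big]=0$$ and $$\sigma_3=r_3-\sqrt{M^2-1}\left(\frac{2r_3^2(1-r_3^{\alpha-2})}{1-r_3}+r_3^\alpha+\frac{r_3^2(1-r_3^\alpha)}{(1-r_3)^2}\right).$$ In particular, if $|F(z)|\le 1$ for all $z\in\mathbb{D}$ and $F(0)=\lambda_F(0)-1=0$, then $F$ is univalent and maps $\mathbb{D}$ onto $\mathbb{D}$.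
   Context: $\mathbb{D}$ is the open unit disk in $\mathbb{C}$ and $\mathbb{D}_r=\{z:|z|<r\}$. A continuous function $F:\Omega\to\mathbb{C}$ on a domain $\Omega\subseteq\mathbb{C}$ is polyanalytic of order $\alpha$ if $\partial^\alpha F/\partial\bar z^\alpha=0$ on $\Omega$; equivalently $F(z)=\sum_{k=0}^{\alpha-1}\bar z^kA_k(z)$ with each $A_k$ analytic in $\Omega$. With $F_z=\frac12(F_x-iF_y)$ and $F_{\bar z}=\frac12(F_x+iF_y)$, set $\lambda_F(z)=\big||F_z(z)|-|F_{\bar z}(z)|\big|$. Univalent means injective. A schlicht disk in the range of $F$ is a disk which is the univalent image under $F$ of some region. $\arg$ denotes the principal argument in $(-\pi,\pi]$. *)

(* Defs.v *)
From Stdlib Require Import Reals Lra Psatz.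
From Coquelicot Require Import Coquelicot.
Open Scope R_scope.

Definition disk (r : R) (z : C) : Prop := Cmod z < r.

Definition analytic_on (Omega : C -> Prop) (f : C -> C) : Prop :=
  forall z, Omega z -> @ex_derive C_AbsRing C_NormedModule f z.

(* [sum_n f N] has the N + 1 terms f 0, ..., f N, so [sum_n _ (alpha - 1)]
   is the sum over k < alpha when alpha >= 1. *)
Definition polyanalytic_expansion (alpha : nat) (Omega : C -> Prop)
    (A : nat -> C -> C) (F : C -> C) : Prop :=
  (forall k, (k < alpha)%nat -> analytic_on Omega (A k)) /\
  (forall z, Omega z ->
     F z = sum_n (fun k => (Cpow (Cconj z) k * A k z)%C) (alpha - 1)).

Definition partial_x (F : C -> C) (z : C) : C :=
  (Derive (fun t => Re (F (t, Im z))) (Re z),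
   Derive (fun t => Im (F (t, Im z))) (Re z)).

Definition partial_y (F : C -> C) (z : C) : C :=
  (Derive (fun t => Re (F (Re z, t))) (Im z),
   Derive (fun t => Im (F (Re z, t))) (Im z)).

Definition partial_z (F : C -> C) (z : C) : C :=
  (/ 2 * (partial_x F z - Ci * partial_y F z))%C.

Definition partial_zbar (F : C -> C) (z : C) : C :=
  (/ 2 * (partial_x F z + Ci * partial_y F z))%C.

Definition lambda (F : C -> C) (z : C) : R :=
  Rabs (Cmod (partial_z F z) - Cmod (partial_zbar F z)).

(* Principal argument; the value at 0 is irrelevant.  [Arg_spec] shows that
   it is the polar angle in (-PI, PI]. *)
Definition Arg (z : C) : R :=
  if Rle_dec 0 (Im z) then acos (Re z / Cmod z) else - acos (Re z / Cmod z).

Lemma Arg_spec (z : C) : z <> RtoC 0 ->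
  - PI < Arg z <= PI /\
  z = (Cmod z * cos (Arg z), Cmod z * sin (Arg z)).
Proof.
intros Hz.
assert (Hm : 0 < Cmod z) by now apply Cmod_gt_0.
assert (Hsq : Cmod z * Cmod z = fst z * fst z + snd z * snd z).
{ unfold Cmod. rewrite sqrt_sqrt; [ring | nra]. }
set (m := Cmod z) in *.
assert (Hx : -1 <= fst z / m <= 1).
{ split.
  - apply Rmult_le_reg_r with m; trivial.
    unfold Rdiv; rewrite Rmult_assoc, Rinv_l by lra; nra.
  - apply Rmult_le_reg_r with m; trivial.
    unfold Rdiv; rewrite Rmult_assoc, Rinv_l by lra; nra. }
assert (Hs : sqrt (1 - (fst z / m)²) = Rabs (snd z) / m).
{ assert (E : 1 - (fst z / m)² = (Rabs (snd z) / m)²).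
  { unfold Rsqr.
    replace (Rabs (snd z) / m * (Rabs (snd z) / m))
      with ((Rabs (snd z) * Rabs (snd z)) / (m * m)) by (field; lra).
    rewrite <- Rabs_mult, Rabs_pos_eq by nra.
    replace (snd z * snd z) with (m * m - fst z * fst z) by lra.
    field; lra. }
  rewrite E, sqrt_Rsqr; trivial.
  apply Rmult_le_pos; [apply Rabs_pos | left; now apply Rinv_0_lt_compat]. }
pose proof (acos_bound (fst z / m)) as Hb.
unfold Arg; fold m; unfold Re, Im.
destruct (Rle_dec 0 (snd z)) as [H|H].
- split; [pose proof PI_RGT_0; lra|].
  rewrite cos_acos, sin_acos, Hs, Rabs_pos_eq by trivial.
  rewrite (surjective_pairing z) at 1; f_equal; field; lra.
- assert (Hlt : acos (fst z / m) < PI).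
  { destruct (Rle_lt_or_eq_dec _ _ (proj2 Hb)) as [L|E]; trivial.
    exfalso.
    assert (E2 : sqrt (1 - (fst z / m)²) = 0)
      by (rewrite <- sin_acos, E by trivial; apply sin_PI).
    rewrite Hs, Rabs_left in E2 by lra.
    apply (Rmult_eq_compat_r m) in E2.
    unfold Rdiv in E2; rewrite Rmult_assoc, Rinv_l in E2 by lra; lra. }
  split; [lra|].
  rewrite cos_neg, sin_neg, cos_acos, sin_acos, Hs, Rabs_left
    by (trivial; lra).
  rewrite (surjective_pairing z) at 1; f_equal; field; lra.
Qed.

Definition univalent_on (F : C -> C) (Omega : C -> Prop) : Prop :=
  forall z w, Omega z -> Omega w -> F z = F w -> z = w.

Definition image (F : C -> C) (Omega : C -> Prop) (w : C) : Prop :=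
  exists z, Omega z /\ F z = w.

Definition connected (U : C -> Prop) : Prop :=
  forall V W : C -> Prop, open V -> open W ->
    (forall z, U z -> V z \/ W z) ->
    (exists z, U z /\ V z) -> (exists z, U z /\ W z) ->
    exists z, U z /\ V z /\ W z.

Definition region (U : C -> Prop) : Prop :=
  (exists z, U z) /\ open U /\ connected U.

(* The disk of radius sigma about 0 is the univalent image under F of some
   region inside Omega.  Regions are nonempty, so this forces sigma > 0. *)
Definition contains_schlicht_disk (F : C -> C) (Omega : C -> Prop) (sigma : R)
    : Prop :=
  exists U, region U /\ (forall z, U z -> Omega z) /\ univalent_on F U /\
    (forall w, image F U w <-> disk sigma w).

Definition least_positive_root (f : R -> R) (r : R) : Prop :=
  0 < r /\ f r = 0 /\ forall t, 0 < t -> f t = 0 -> r <= t.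

(* Main.v *)
Require Import Defs.
From Stdlib Require Import Reals List Permutation Lra Lia Ranalysis5 ClassicalEpsilon.
From Coquelicot Require Import Coquelicot.
Open Scope R_scope.

(** On the circle [|z| = r] the function is the trigonometric sum of the
    [a_(n,k) r^(n+k)] at the frequencies [n - k], and the mean value of [|F|^2]
    is at most [M^2].  Coefficients that share a frequency have, by the condition
    on arguments, products [a * Cconj b] of nonnegative real part; so the cross
    terms only increase the mean value, and the sum of all [|a_(n,k)|^2] is at
    most [M^2] ([bessel], [coef_bound]).

    The coefficients [b = a_(1,0)] and [c = a_(0,1)] are the Wirtinger
    derivatives at the origin ([partial_0]), so [||b| - |c|| = 1], whence
    [|b|^2 + |c|^2 >= 1], and every coefficient of a term of degree at least two
    is bounded by [K = sqrt (M^2 - 1)].  Write [F = L + G], where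
    [L z = b z + c Cconj z] is real linear and stretches distances by at least
    [1].  On the disk of radius [r] the map [G] has Lipschitz constant at most
    [K] times the sum of the [(n+k) r^(n+k-1)] over [n + k >= 2]
    ([remainder_lipschitz]), and modulus at most [K] times the sum of the
    [r^(n+k)] ([remainder_growth]).  The radius [r3] is the one at which the
    first bound reaches [1], and [sigma3] is [r3] minus the second bound there.

    Below [r3] the function is thus a linear map that shortens no distance plus a perturbation
    with Lipschitz constant below [1]: it is univalent, and Banach's fixed point
    theorem solves [F z = v] for all [|v| < sigma3]
    ([perturbed_linear_schlicht]).  The radius [sigma3] is positive because, as a
    function of [r], it has derivative [1] minus the Lipschitz bound
    ([schlicht_radius_pos]).

    When [M = 1] there is no room for any further coefficient: one of [b], [c]
    has modulus [1], the other vanishes, and [F] is a rotation, possibly composed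
    with conjugation. *)

(** * Finite sums over lists *)

Definition sumR {T : Type} (f : T -> R) (l : list T) : R :=
  fold_right (fun p s => f p + s) 0 l.

Definition sumC {T : Type} (f : T -> C) (l : list T) : C :=
  fold_right (fun p s => (f p + s)%C) (RtoC 0) l.

Lemma sumR_app {T} (f : T -> R) l l' : sumR f (l ++ l') = sumR f l + sumR f l'.
Proof. induction l as [|p l IH]; simpl; [ring | rewrite IH; ring]. Qed.

Lemma sumC_app {T} (f : T -> C) l l' :
  sumC f (l ++ l') = (sumC f l + sumC f l')%C.
Proof. induction l as [|p l IH]; simpl; [ring | rewrite IH; ring]. Qed.

Lemma sumR_map {S T} (h : S -> T) (f : T -> R) l :
  sumR f (map h l) = sumR (fun x => f (h x)) l.
Proof. induction l as [|p l IH]; simpl; [reflexivity | now rewrite IH]. Qed.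

Lemma sumC_map {S T} (h : S -> T) (f : T -> C) l :
  sumC f (map h l) = sumC (fun x => f (h x)) l.
Proof. induction l as [|p l IH]; simpl; [reflexivity | now rewrite IH]. Qed.

Lemma sumR_list_prod {S T} (f : S * T -> R) l l' :
  sumR f (list_prod l l') = sumR (fun k => sumR (fun n => f (k, n)) l') l.
Proof.
induction l as [|k l IH]; simpl; [reflexivity|].
now rewrite sumR_app, IH, sumR_map.
Qed.

Lemma sumC_list_prod {S T} (f : S * T -> C) l l' :
  sumC f (list_prod l l') = sumC (fun k => sumC (fun n => f (k, n)) l') l.
Proof.
induction l as [|k l IH]; simpl; [reflexivity|].
now rewrite sumC_app, IH, sumC_map.
Qed.

Lemma sumR_perm {T} (f : T -> R) l l' :
  Permutation l l' -> sumR f l = sumR f l'.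
Proof. induction 1; simpl; try lra. Qed.

Lemma sumC_perm {T} (f : T -> C) l l' :
  Permutation l l' -> sumC f l = sumC f l'.
Proof.
induction 1 as [| x l l' _ IH | x y l | l l' l'' _ IH _ IH']; simpl.
- reflexivity.
- now rewrite IH.
- ring.
- congruence.
Qed.

Lemma sumR_le {T} (f g : T -> R) l :
  (forall p, In p l -> f p <= g p) -> sumR f l <= sumR g l.
Proof.
induction l as [|p l IH]; simpl; intros H; [lra|].
apply Rplus_le_compat; [apply H; now left | apply IH; auto].
Qed.

Lemma sumR_ext {T} (f g : T -> R) l :
  (forall p, In p l -> f p = g p) -> sumR f l = sumR g l.
Proof. intros H; apply Rle_antisym; apply sumR_le; intros; rewrite H; trivial; lra. Qed.

Lemma sumC_ext {T} (f g : T -> C) l :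
  (forall p, In p l -> f p = g p) -> sumC f l = sumC g l.
Proof.
induction l as [|p l IH]; simpl; intros H; [reflexivity|].
rewrite H by now left. rewrite IH; auto.
Qed.

Lemma sumR_nonneg {T} (f : T -> R) l :
  (forall p, In p l -> 0 <= f p) -> 0 <= sumR f l.
Proof.
induction l as [|p l IH]; simpl; intros H; [lra|].
apply Rplus_le_le_0_compat; [apply H; now left | apply IH; auto].
Qed.

Lemma sumR_term {T} (f : T -> R) l p :
  (forall q, In q l -> 0 <= f q) -> In p l -> f p <= sumR f l.
Proof.
induction l as [|q l IH]; simpl; intros Hf; [easy|intros [->|Hp]].
- assert (0 <= sumR f l) by (apply sumR_nonneg; auto). lra.
- assert (0 <= f q) by auto. assert (f p <= sumR f l) by auto. lra.
Qed.

Lemma sumR_scal {T} (c : R) (f : T -> R) l :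
  sumR (fun p => c * f p) l = c * sumR f l.
Proof. induction l as [|p l IH]; simpl; [ring | rewrite IH; ring]. Qed.

Lemma sumR_plus {T} (f g : T -> R) l :
  sumR (fun p => f p + g p) l = sumR f l + sumR g l.
Proof. induction l as [|p l IH]; simpl; [ring | rewrite IH; ring]. Qed.

Lemma sumC_minus {T} (f g : T -> C) l :
  sumC (fun p => f p - g p)%C l = (sumC f l - sumC g l)%C.
Proof. induction l as [|p l IH]; simpl; [ring | rewrite IH; ring]. Qed.

Lemma sumC_scal {T} (c : C) (f : T -> C) l :
  sumC (fun p => c * f p)%C l = (c * sumC f l)%C.
Proof. induction l as [|p l IH]; simpl; [ring | rewrite IH; ring]. Qed.

Lemma Cmod_sumC {T} (f : T -> C) l :
  Cmod (sumC f l) <= sumR (fun p => Cmod (f p)) l.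
Proof.
induction l as [|p l IH]; simpl; [rewrite Cmod_0; lra|].
eapply Rle_trans; [apply Cmod_triangle|]. lra.
Qed.

Lemma sum_n_sumC (u : nat -> C) N :
  @sum_n C_AbelianGroup u N = sumC u (seq 0 (S N)).
Proof.
induction N as [|N IH].
- rewrite sum_O; change (u 0%nat = (u 0%nat + 0)%C); ring.
- rewrite sum_Sn, IH, (seq_S (S N) 0), sumC_app.
  change ((sumC u (seq 0 (S N)) + u (S N))%C
          = (sumC u (seq 0 (S N)) + (u (S N) + 0))%C).
  ring.
Qed.

(** * Index pairs *)

(** In a pair the first component is the exponent of [Cconj z] and the second
    that of [z], so that rows of the grid are the power series of the
    coefficient functions [A k]. *)
Definition grid (alpha T : nat) : list (nat * nat) :=
  list_prod (seq 0 alpha) (seq 0 T).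

Definition higher (alpha T : nat) : list (nat * nat) :=
  filter (fun p => Nat.leb 2 (fst p + snd p)) (grid alpha T).

Lemma NoDup_list_prod {S T} (l : list S) (l' : list T) :
  NoDup l -> NoDup l' -> NoDup (list_prod l l').
Proof.
intros Hl Hl'; induction Hl as [|x l Hx Hl IH]; simpl; [constructor|].
apply NoDup_app; trivial.
- apply NoDup_map_NoDup_ForallPairs; trivial.
  intros y y' _ _ E; congruence.
- intros [x' y] H1 H2. apply in_map_iff in H1 as [y' [E _]].
  apply in_prod_iff in H2 as [H2 _]. congruence.
Qed.

Lemma grid_NoDup alpha T : NoDup (grid alpha T).
Proof. apply NoDup_list_prod; apply seq_NoDup. Qed.

Lemma in_grid alpha T p :
  In p (grid alpha T) <-> (fst p < alpha /\ snd p < T)%nat.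
Proof.
destruct p as [k n]; unfold grid; rewrite in_prod_iff, !in_seq; simpl; lia.
Qed.

Lemma in_higher alpha T p :
  In p (higher alpha T) <->
  (fst p < alpha /\ snd p < T /\ 2 <= fst p + snd p)%nat.
Proof. unfold higher; rewrite filter_In, in_grid, Nat.leb_le; tauto. Qed.

(** The constant term and the two linear terms play a special part in every
    sum over the grid below; a permutation isolates them once for all. *)
Lemma grid_perm alpha T : (2 <= alpha)%nat -> (2 <= T)%nat ->
  Permutation (grid alpha T)
    ((0, 0) :: (0, 1) :: (1, 0) :: higher alpha T)%nat.
Proof.
intros Ha HT; apply NoDup_Permutation.
- apply grid_NoDup.
- repeat constructor; simpl; rewrite ?in_higher; simpl;
    try (intros H; decompose [or and] H; try congruence; lia).
  apply NoDup_filter, grid_NoDup.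
- intros [k n]; simpl; rewrite in_higher, in_grid; simpl.
  split.
  + intros [H1 H2].
    destruct k as [|[|k]], n as [|[|n]]; auto; right; right; right; lia.
  + intros [E|[E|[E|E]]]; [injection E as <- <-; lia ..|lia].
Qed.

(** * Bessel's inequality for trigonometric polynomials *)

Definition wave (m : Z) (t : R) : C := (cos (IZR m * t), sin (IZR m * t)).

Definition trig {T : Type} (c : T -> C) (m : T -> Z) (l : list T) (t : R) : C :=
  sumC (fun p => c p * wave (m p) t)%C l.

Lemma sin_int_period (d : Z) : sin (IZR d * (2 * PI)) = 0.
Proof. apply sin_eq_0_1; exists (2 * d)%Z; rewrite mult_IZR; ring. Qed.

Lemma cos_int_period (d : Z) : cos (IZR d * (2 * PI)) = 1.
Proof.
replace (IZR d * (2 * PI)) with (2 * (IZR d * PI)) by ring.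
rewrite cos_2a_sin, (sin_eq_0_1 (IZR d * PI)); [ring | now exists d].
Qed.

Lemma is_RInt_wave (x y : R) (d : Z) :
  is_RInt (fun t => x * cos (IZR d * t) - y * sin (IZR d * t)) 0 (2 * PI)
    (if Z.eq_dec d 0 then 2 * PI * x else 0).
Proof.
destruct (Z.eq_dec d 0) as [->|Hd].
- apply (is_RInt_ext (fun _ => x)).
  + intros t _; rewrite Rmult_0_l, cos_0, sin_0; simpl; ring.
  + replace (2 * PI * x) with (scal (2 * PI - 0) x)
      by (unfold scal; simpl; unfold mult; simpl; ring).
    apply (@is_RInt_const R_NormedModule).
- assert (Hd' : IZR d <> 0) by (now apply not_0_IZR).
  (* An antiderivative, which takes the same value at both ends. *)
  set (P := fun t => (x * sin (IZR d * t) + y * cos (IZR d * t)) / IZR d).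
  replace 0 with (minus (P (2 * PI)) (P 0)) at 2.
  + apply (@is_RInt_derive R_CompleteNormedModule P).
    * intros t _; unfold P; auto_derive; trivial. field; trivial.
    * intros t _. apply (ex_derive_continuous (K := R_AbsRing) (V := R_NormedModule)).
      auto_derive; trivial.
  + unfold P, minus, plus, opp; simpl.
    rewrite sin_int_period, cos_int_period, !Rmult_0_r, sin_0, cos_0.
    field; trivial.
Qed.

(** The cross terms of [|sum c_p wave (m p)|^2] are again waves, of frequency
    the difference of the two frequencies. *)
Lemma wave_cross (a b : C) (m m' : Z) (t : R) :
  Re (a * wave m t * Cconj (b * wave m' t))%C
  = Re (a * Cconj b)%C * cos (IZR (m - m') * t)
    - Im (a * Cconj b)%C * sin (IZR (m - m') * t).
Proof.
rewrite minus_IZR.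
replace ((IZR m - IZR m') * t) with (IZR m * t - IZR m' * t) by ring.
rewrite cos_minus, sin_minus.
destruct a, b; unfold wave, Cconj, Cmult, Re, Im; simpl; ring.
Qed.

Lemma cross_integral {T : Type} (c : T -> C) (m : T -> Z) (l : list T) (p : T) :
  (forall q, In q l -> m p = m q -> 0 <= Re (c p * Cconj (c q))%C) ->
  exists J : R,
    is_RInt (fun t => Re (c p * wave (m p) t * Cconj (trig c m l t))%C)
      0 (2 * PI) J /\ 0 <= J.
Proof.
induction l as [|q l IH]; intros H.
- exists 0; split; [|lra].
  replace 0 with (scal (2 * PI - 0) 0) at 2
    by (unfold scal; simpl; unfold mult; simpl; ring).
  apply (is_RInt_ext (fun _ => 0)).
  + intros t _; unfold trig, Cconj, Cmult, Re; simpl; ring.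
  + apply (@is_RInt_const R_NormedModule).
- destruct IH as [J [HJ HJ0]]; [intros; apply H; trivial; now right|].
  pose proof (is_RInt_wave (Re (c p * Cconj (c q))%C)
                (Im (c p * Cconj (c q))%C) (m p - m q)) as HK.
  eexists; split.
  + refine (is_RInt_ext _ _ _ _ _ _ (is_RInt_plus _ _ _ _ _ _ HK HJ)).
    intros t _; cbv beta; rewrite <- wave_cross.
    unfold trig; simpl. unfold plus, Cconj, Cmult, Cplus, Re; simpl; ring.
  + unfold plus; simpl. destruct (Z.eq_dec _ _) as [E|E]; [|lra].
    apply Rplus_le_le_0_compat; trivial.
    apply Rmult_le_pos; [pose proof PI_RGT_0; lra|].
    apply H; [now left | lia].
Qed.

(** The inductive step for expanding the square of a trigonometric sum: a wave
    has modulus one, so its term contributes a constant and cross terms. *)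
Lemma Cmod2_add_wave (a u : C) (m : Z) (t : R) :
  Cmod (a * wave m t + u)%C ^ 2
  = Cmod a ^ 2 + Cmod u ^ 2 + 2 * Re (a * wave m t * Cconj u)%C.
Proof.
rewrite !Cmod2_alt.
pose proof (sin2_cos2 (IZR m * t)) as E.
destruct u as [u1 u2], a as [x y]; unfold wave, Rsqr in *; simpl.
set (s := sin (IZR m * t)) in *; set (k := cos (IZR m * t)) in *.
replace (x * (x * 1) + y * (y * 1))
  with ((x * x + y * y) * (s * s + k * k)) by (rewrite E; ring).
ring.
Qed.

(** The integral is given as a witness, so that integrability is part of
    the induction. *)
Lemma square_integral {T : Type} (c : T -> C) (m : T -> Z) (l : list T) :
  NoDup l ->
  (forall p q, In p l -> In q l -> p <> q -> m p = m q ->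
     0 <= Re (c p * Cconj (c q))%C) ->
  exists I : R,
    is_RInt (fun t => Cmod (trig c m l t) ^ 2) 0 (2 * PI) I /\
    2 * PI * sumR (fun p => Cmod (c p) ^ 2) l <= I.
Proof.
induction 1 as [|p l Hp Hl IH]; intros H.
- exists 0; split; [|simpl; lra].
  replace 0 with (scal (2 * PI - 0) 0) at 2
    by (unfold scal; simpl; unfold mult; simpl; ring).
  apply (is_RInt_ext (fun _ => 0)).
  + intros t _; unfold trig; simpl; rewrite Cmod_0; ring.
  + apply (@is_RInt_const R_NormedModule).
- destruct IH as [I [HI HI0]]; [intros; apply H; trivial; now right|].
  destruct (cross_integral c m l p) as [J [HJ HJ0]].
  { intros q Hq E; apply H; trivial; [now left | now right | congruence]. }
  pose proof (@is_RInt_const R_NormedModule 0 (2 * PI) (Cmod (c p) ^ 2)) as HK.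
  eexists; split.
  + refine (is_RInt_ext _ _ _ _ _ _
      (is_RInt_plus _ _ _ _ _ _ HK
        (is_RInt_plus _ _ _ _ _ _ HI
          (is_RInt_plus _ _ _ _ _ _ HJ HJ)))).
    intros t _; cbv beta.
    change (trig c m (p :: l) t)
      with (c p * wave (m p) t + trig c m l t)%C.
    rewrite Cmod2_add_wave; unfold plus; simpl; ring.
  + unfold plus, scal; simpl; unfold mult; simpl. simpl in HI0. lra.
Qed.

(** Averaging [|trig|^2] over a period leaves the squares of the coefficients
    and the cross terms of equal frequency; the sign condition makes the
    latter nonnegative, so they can be dropped. *)
Lemma bessel {T : Type} (c : T -> C) (m : T -> Z) (l : list T) (B : R) :
  NoDup l ->
  (forall p q, In p l -> In q l -> p <> q -> m p = m q ->
     0 <= Re (c p * Cconj (c q))%C) ->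
  (forall t, Cmod (trig c m l t) <= B) ->
  sumR (fun p => Cmod (c p) ^ 2) l <= B ^ 2.
Proof.
intros Hl H HB.
destruct (square_integral c m l Hl H) as [I [HI HI0]].
pose proof PI_RGT_0 as Hpi.
assert (I <= scal (2 * PI - 0) (B ^ 2)) as HIB.
{ apply (is_RInt_le _ _ 0 (2 * PI) _ _ ltac:(lra) HI
          (@is_RInt_const R_NormedModule 0 (2 * PI) (B ^ 2))).
  intros t _; apply pow_incr; split; [apply Cmod_ge_0 | apply HB]. }
unfold scal in HIB; simpl in HIB; unfold mult in HIB; simpl in HIB.
apply Rmult_le_reg_l with (2 * PI); simpl in *; lra.
Qed.

Definition monomial (z : C) (p : nat * nat) : C :=
  (Cconj z ^ fst p * z ^ snd p)%C.

(** On a circle about the origin conjugation inverts the phase, so the exponent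
    of [Cconj z] counts negatively. *)
Definition freq (p : nat * nat) : Z := (Z.of_nat (snd p) - Z.of_nat (fst p))%Z.

Definition circle (r t : R) : C := (r * cos t, r * sin t).

Lemma monomial_circle (r t : R) (p : nat * nat) :
  monomial (circle r t) p
  = (RtoC (r ^ (fst p + snd p)) * wave (freq p) t)%C.
Proof.
destruct p as [k n]; unfold monomial, freq; simpl (fst _); simpl (snd _).
assert (Hn : forall n, (circle r t ^ n
            = RtoC (r ^ n) * wave (Z.of_nat n) t)%C).
{ clear; induction n as [|n IH].
  - unfold circle, wave; simpl (IZR _); rewrite Rmult_0_l, cos_0, sin_0; simpl.
    apply injective_projections; simpl; ring.
  - rewrite Cpow_S, IH; unfold circle, wave.
    rewrite <- !INR_IZR_INZ, S_INR, Rmult_plus_distr_r, Rmult_1_l, cos_plus, sin_plus.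
    apply injective_projections; simpl; ring. }
assert (Hk : (Cconj (circle r t) ^ k
            = RtoC (r ^ k) * wave (- Z.of_nat k) t)%C).
{ rewrite <- Cpow_conj, Hn; unfold wave.
  rewrite opp_IZR, Ropp_mult_distr_l_reverse, cos_neg, sin_neg.
  apply injective_projections; simpl; ring. }
rewrite Hn, Hk, pow_add; unfold wave.
rewrite minus_IZR, opp_IZR.
replace ((IZR (Z.of_nat n) - IZR (Z.of_nat k)) * t)
  with (IZR (Z.of_nat n) * t + - IZR (Z.of_nat k) * t) by ring.
rewrite cos_plus, sin_plus.
apply injective_projections; simpl; ring.
Qed.

(** * Truncations *)

Lemma pseries_partial_sums (a : nat -> C) (z l : C) :
  @is_pseries C_AbsRing C_NormedModule a z l ->
  forall eps, 0 < eps -> exists N, forall T, (N <= T)%nat ->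
    Cmod (sumC (fun n => a n * z ^ n)%C (seq 0 T) - l)%C < eps.
Proof.
intros H eps He.
pose proof (proj1 (filterlim_locally_ball_norm _ _) H (mkposreal eps He)) as [N HN].
exists (S N); intros [|T] HT; [lia|].
specialize (HN T ltac:(lia)).
change (Cmod (sum_n (fun k => Cmult (pow_n (K := C_AbsRing) z k) (a k)) T - l)%C < eps) in HN.
rewrite sum_n_sumC in HN.
rewrite (sumC_ext _ (fun n => Cmult (pow_n (K := C_AbsRing) z n) (a n))); trivial.
intros n _; apply Cmult_comm.
Qed.

Lemma geom_sum (q : R) T :
  (1 - q) * sumR (fun n => q ^ n) (seq 0 T) = 1 - q ^ T.
Proof.
induction T as [|T IH]; [simpl; ring|].
rewrite seq_S, sumR_app, Rmult_plus_distr_l, IH; simpl; ring.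
Qed.

Lemma seq_split (N m : nat) : seq 0 (N + m) = seq 0 N ++ map (Nat.add N) (seq 0 m).
Proof.
rewrite seq_app; f_equal; simpl.
induction m as [|m IH]; [reflexivity|].
now rewrite !seq_S, map_app, IH.
Qed.

(** The terms of a series converging at a radius between [rho] and [1] are
    eventually at most [1] there, which makes the remainder on the smaller
    disk a geometric one. *)
Lemma pseries_uniform (a : nat -> C) (f : C -> C) (rho : R) :
  0 <= rho < 1 ->
  (forall z, disk 1 z -> @is_pseries C_AbsRing C_NormedModule a z (f z)) ->
  forall eps, 0 < eps -> exists N, forall T, (N <= T)%nat ->
    forall z, Cmod z <= rho ->
    Cmod (sumC (fun n => a n * z ^ n)%C (seq 0 T) - f z)%C <= eps.
Proof.
intros Hr H eps He.
set (s := (rho + 1) / 2).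
assert (Hs : rho < s < 1) by (unfold s; lra).
set (q := rho / s).
assert (Hq : 0 <= q < 1).
{ unfold q; split; [apply Rdiv_le_0_compat; lra|].
  apply Rmult_lt_reg_r with s; [lra|]. unfold Rdiv.
  rewrite Rmult_assoc, Rinv_l; lra. }
assert (Hcs : Cmod (RtoC s) = s) by (rewrite Cmod_R, Rabs_pos_eq; lra).
assert (Hterm : exists N, forall n, (N <= n)%nat -> Cmod (a n) * s ^ n <= 1).
{ destruct (pseries_partial_sums a (RtoC s) _
    (H _ ltac:(unfold disk; rewrite Hcs; lra)) (1 / 2) ltac:(lra)) as [N HN].
  exists N; intros n Hn.
  pose proof (HN n Hn) as H1. pose proof (HN (S n) ltac:(lia)) as H2.
  rewrite seq_S, sumC_app in H2; simpl in H2.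
  set (S0 := sumC _ _) in *. set (l := f s) in *.
  replace (Cmod (a n) * s ^ n) with (Cmod (a n * RtoC s ^ n))
    by (now rewrite Cmod_mult, Cmod_pow, Hcs).
  (* A term is the difference of two consecutive partial sums. *)
  replace (a n * RtoC s ^ n)%C
    with ((S0 + (a n * RtoC s ^ n + 0) - l) + - (S0 - l))%C by ring.
  eapply Rle_trans; [apply Cmod_triangle|]. rewrite Cmod_opp. lra. }
destruct Hterm as [N1 HN1].
destruct (pow_lt_1_zero q ltac:(rewrite Rabs_pos_eq; lra) (eps / 2 * (1 - q))
            ltac:(apply Rmult_lt_0_compat; lra)) as [N2 HN2].
exists (max N1 N2); intros T HT z Hz.
destruct (pseries_partial_sums a z _
    (H z ltac:(unfold disk; lra)) (eps / 2) ltac:(lra)) as [N3 HN3].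
specialize (HN3 (T + N3)%nat ltac:(lia)).
rewrite seq_split, sumC_app, sumC_map in HN3.
set (ST := sumC _ (seq 0 T)) in *.
set (tl := sumC _ (seq 0 N3)) in *.
assert (Htl : Cmod tl <= eps / 2).
{ unfold tl; eapply Rle_trans; [apply Cmod_sumC|].
  apply Rle_trans with (sumR (fun n => q ^ T * q ^ n) (seq 0 N3)).
  - apply sumR_le; intros n _.
    rewrite <- pow_add, Cmod_mult, Cmod_pow.
    specialize (HN1 (T + n)%nat ltac:(lia)).
    assert (Hzq : Cmod z ^ (T + n) <= q ^ (T + n) * s ^ (T + n)).
    { rewrite <- Rpow_mult_distr. apply pow_incr; split; [apply Cmod_ge_0|].
      unfold q, Rdiv; rewrite Rmult_assoc, Rinv_l; lra. }
    assert (0 <= q ^ (T + n)) by (apply pow_le; lra).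
    pose proof (Cmod_ge_0 (a (T + n)%nat)).
    apply Rle_trans with (q ^ (T + n) * (Cmod (a (T + n)%nat) * s ^ (T + n))); nra.
  - rewrite sumR_scal.
    specialize (HN2 T ltac:(lia)).
    assert (0 <= q ^ T) by (apply pow_le; lra).
    rewrite Rabs_pos_eq in HN2 by trivial.
    pose proof (geom_sum q N3) as E.
    assert (0 <= q ^ N3) by (apply pow_le; lra).
    assert (0 <= sumR (fun n => q ^ n) (seq 0 N3))
      by (apply sumR_nonneg; intros; apply pow_le; lra).
    set (G := sumR _ _) in *.
    apply Rle_trans with (eps / 2 * (1 - q) * G); [nra|].
    rewrite Rmult_assoc, E. nra. }
replace (ST - f z)%C with ((ST + tl - f z) + - tl)%C by ring.
eapply Rle_trans; [apply Cmod_triangle|]. rewrite Cmod_opp. lra.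
Qed.

Definition trunc (a : nat -> nat -> C) (alpha T : nat) (z : C) : C :=
  sumC (fun p => a (snd p) (fst p) * monomial z p)%C (grid alpha T).

(** Stated for an arbitrary list of rows for the sake of the induction. *)
Lemma rows_uniform (a : nat -> nat -> C) (A : nat -> C -> C) (rho : R)
    (ks : list nat) :
  0 <= rho < 1 ->
  (forall k, In k ks -> forall z, disk 1 z ->
     @is_pseries C_AbsRing C_NormedModule (fun n => a n k) z (A k z)) ->
  forall eps, 0 < eps -> exists N, forall T, (N <= T)%nat ->
    forall z, Cmod z <= rho ->
    Cmod (sumC (fun k => sumC (fun n => a n k * monomial z (k, n))%C (seq 0 T)) ks
          - sumC (fun k => Cconj z ^ k * A k z)%C ks)%C <= eps.
Proof.
intros Hr; induction ks as [|k ks IH]; intros H eps He.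
- exists 0%nat; intros; simpl.
  replace (0 - 0)%C with (RtoC 0) by ring. rewrite Cmod_0; lra.
- destruct (IH ltac:(intros; apply H; trivial; now right) (eps / 2) ltac:(lra))
    as [N1 HN1].
  destruct (pseries_uniform (fun n => a n k) (A k) rho Hr
    ltac:(intros; apply H; trivial; now left) (eps / 2) ltac:(lra)) as [N2 HN2].
  exists (max N1 N2); intros T HT z Hz; simpl.
  specialize (HN1 T ltac:(lia) z Hz). specialize (HN2 T ltac:(lia) z Hz).
  rewrite (sumC_ext (fun n => a n k * monomial z (k, n))%C
             (fun n => Cconj z ^ k * (a n k * z ^ n))%C)
    by (intros; unfold monomial; simpl; ring).
  rewrite sumC_scal.
  set (u := sumC _ (seq 0 T)) in *.
  set (v := sumC (fun k => sumC (fun n => a n k * monomial z (k, n))%C (seq 0 T)) ks)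
    in *.
  set (w := sumC (fun k => Cconj z ^ k * A k z)%C ks) in *.
  replace (Cconj z ^ k * u + v - (Cconj z ^ k * A k z + w))%C
    with (Cconj z ^ k * (u - A k z) + (v - w))%C by ring.
  eapply Rle_trans; [apply Cmod_triangle|].
  rewrite Cmod_mult, Cmod_pow, Cmod_conj.
  assert (Cmod z ^ k <= 1).
  { rewrite <- (pow1 k); apply pow_incr; split; [apply Cmod_ge_0 | lra]. }
  assert (0 <= Cmod z ^ k) by (apply pow_le, Cmod_ge_0).
  pose proof (Cmod_ge_0 (u - A k z)%C). nra.
Qed.

Lemma trunc_uniform alpha F A (a : nat -> nat -> C) (rho : R) :
  (1 <= alpha)%nat ->
  polyanalytic_expansion alpha (disk 1) A F ->
  (forall k, (k < alpha)%nat -> forall z, disk 1 z ->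
     @is_pseries C_AbsRing C_NormedModule (fun n => a n k) z (A k z)) ->
  0 <= rho < 1 ->
  forall eps, 0 < eps -> exists N, forall T, (N <= T)%nat ->
    forall z, Cmod z <= rho -> Cmod (trunc a alpha T z - F z)%C <= eps.
Proof.
intros Hal HF Ha Hr eps He.
destruct (rows_uniform a A rho (seq 0 alpha) Hr
  ltac:(intros k Hk; apply Ha; apply in_seq in Hk; lia) eps He) as [N HN].
exists N; intros T HT z Hz.
rewrite (proj2 HF z) by (unfold disk; lra).
rewrite sum_n_sumC. replace (S (alpha - 1)) with alpha by lia.
unfold trunc, grid; rewrite sumC_list_prod.
now apply HN.
Qed.

(** * Bounds on the coefficients *)

(** [a * Cconj b] is a nonnegative multiple of [a / b], whose real part has the
    sign of the cosine of its argument. *)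
Lemma Re_mul_conj_nonneg (a b : C) :
  (a <> RtoC 0 -> b <> RtoC 0 -> Rabs (Arg (a / b)%C) <= PI / 2) ->
  0 <= Re (a * Cconj b)%C.
Proof.
intros H.
destruct (Ceq_dec a 0) as [->|Ha]; [unfold Cmult, Re; simpl; lra|].
destruct (Ceq_dec b 0) as [->|Hb]; [unfold Cmult, Re; simpl; lra|].
specialize (H Ha Hb).
assert (Hab : (a / b)%C <> RtoC 0).
{ intros E; apply Ha. replace a with (a / b * b)%C by (field; trivial).
  rewrite E; ring. }
destruct (Arg_spec _ Hab) as [_ E].
assert (Hc : 0 <= Re (a / b)%C).
{ rewrite E; unfold Re; simpl. apply Rmult_le_pos; [apply Cmod_ge_0|].
  apply Rabs_le_between in H. apply cos_ge_0; lra. }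
replace (a * Cconj b)%C with (a / b * (b * Cconj b))%C by (field; trivial).
rewrite <- Cmod2_conj, re_scal_r.
apply Rmult_le_pos; trivial. apply pow2_ge_0.
Qed.

Definition coef (a : nat -> nat -> C) (p : nat * nat) : C := a (snd p) (fst p).

Definition degree (p : nat * nat) : nat := (fst p + snd p)%nat.

(** The convergence, uniform on smaller disks, through which [F] is tied to
    its coefficients from here on. *)
Definition truncations_converge (a : nat -> nat -> C) (alpha : nat) (F : C -> C)
    : Prop :=
  forall rho, 0 <= rho < 1 -> forall eps, 0 < eps ->
  exists N, forall T, (N <= T)%nat ->
    forall z, Cmod z <= rho -> Cmod (trunc a alpha T z - F z)%C <= eps.

(** The form in which the condition on arguments is applied: pairs of equal
    frequency that differ have both components different. *)
Definition aligned (a : nat -> nat -> C) (alpha : nat) : Prop :=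
  forall p q, (fst p < alpha)%nat -> (fst q < alpha)%nat ->
    fst p <> fst q -> snd p <> snd q -> 0 <= Re (coef a p * Cconj (coef a q))%C.

Lemma sumR_grid (f : nat * nat -> R) alpha T :
  (2 <= alpha)%nat -> (2 <= T)%nat ->
  sumR f (grid alpha T)
  = f (0, 0)%nat + f (0, 1)%nat + f (1, 0)%nat + sumR f (higher alpha T).
Proof. intros Ha HT; rewrite (sumR_perm _ _ _ (grid_perm alpha T Ha HT)); simpl; ring. Qed.

Lemma le_of_le_square_eps (x M : R) :
  0 <= x -> 0 <= M -> (forall eps, 0 < eps -> x <= (M + eps) ^ 2) -> x <= M ^ 2.
Proof.
intros Hx HM H.
assert (Hs : sqrt x <= M).
{ apply le_epsilon; intros eps He.
  rewrite <- (sqrt_pow2 (M + eps)) by lra. apply sqrt_le_1_alt; auto. }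
rewrite <- (pow2_sqrt x Hx). apply pow_incr; split; trivial; apply sqrt_pos.
Qed.

Lemma pow_ge_linear (r : R) m : 0 <= r <= 1 -> 1 - INR m * (1 - r) <= r ^ m.
Proof.
intros Hr; induction m as [|m IH]; [simpl; lra|].
rewrite S_INR; simpl. pose proof (pos_INR m).
assert (r ^ m <= 1) by (rewrite <- (pow1 m); apply pow_incr; lra). nra.
Qed.

(** The limit [r -> 1] in [s * r ^ m <= y], made quantitative by Bernoulli's
    inequality. *)
Lemma le_of_le_mul_pow (s y : R) m :
  0 <= s -> (forall r, 0 < r < 1 -> s * r ^ m <= y) -> s <= y.
Proof.
intros Hs H; apply le_epsilon; intros eps He.
pose proof (pos_INR m) as Hm.
assert (Hk : 0 <= s * INR m) by nra.
set (h := Rmin (1 / 2) (eps / (s * INR m + 1))).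
assert (Hh : 0 < h).
{ apply Rmin_pos; [lra | apply Rdiv_lt_0_compat; lra]. }
assert (Hh2 : h <= 1 / 2) by apply Rmin_l.
assert (Hh3 : h * (s * INR m + 1) <= eps).
{ replace eps with (eps / (s * INR m + 1) * (s * INR m + 1)) by (field; lra).
  apply Rmult_le_compat_r; [lra | apply Rmin_r]. }
specialize (H (1 - h) ltac:(lra)).
pose proof (pow_ge_linear (1 - h) m ltac:(lra)). nra.
Qed.

(** Bessel's inequality on the circle of radius [r], applied to a truncation
    within [eps] of [F], bounds the sum of the squares of [|coef a q| r^(deg q)]
    by [(M + eps)^2]; only three of the terms are retained.  Then [eps] tends
    to [0] and [r] to [1]. *)
Lemma coef_bound a alpha F M p :
  (2 <= alpha)%nat -> truncations_converge a alpha F -> aligned a alpha ->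
  (forall z, disk 1 z -> Cmod (F z) <= M) ->
  (fst p < alpha)%nat -> (2 <= degree p)%nat ->
  Cmod (a 1 0)%nat ^ 2 + Cmod (a 0 1)%nat ^ 2 + Cmod (coef a p) ^ 2 <= M ^ 2.
Proof.
intros Hal HF Hs HM Hp Hdeg.
assert (HM0 : 0 <= M).
{ eapply Rle_trans; [apply Cmod_ge_0 | apply (HM (RtoC 0))].
  unfold disk; rewrite Cmod_0; lra. }
pose proof (pow2_ge_0 (Cmod (a 1 0)%nat)).
pose proof (pow2_ge_0 (Cmod (a 0 1)%nat)).
pose proof (pow2_ge_0 (Cmod (coef a p))).
apply (le_of_le_mul_pow _ _ (2 * degree p)); [lra|].
intros r Hr.
assert (0 <= r ^ (2 * degree p)) by (apply pow_le; lra).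
apply le_of_le_square_eps; [nra | trivial |].
intros eps He.
destruct (HF r ltac:(lra) eps He) as [N HN].
(* Large enough for the truncation to be close and to contain [p]. *)
set (T := (N + snd p + 2)%nat).
set (c := fun q => (coef a q * RtoC (r ^ degree q))%C).
assert (HB : sumR (fun q => Cmod (c q) ^ 2) (grid alpha T) <= (M + eps) ^ 2).
{ apply (bessel c freq).
  - apply grid_NoDup.
  - intros q q' Hq Hq' Hne Hfr. apply in_grid in Hq, Hq'.
    unfold c.
    replace (coef a q * RtoC (r ^ degree q) * Cconj (coef a q' * RtoC (r ^ degree q')))%C
      with (RtoC (r ^ degree q * r ^ degree q') * (coef a q * Cconj (coef a q')))%C.
    + rewrite re_scal_l. apply Rmult_le_pos.
      { apply Rmult_le_pos; apply pow_le; lra. }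
      unfold freq in Hfr.
      destruct q as [k n], q' as [k' n']; simpl in *.
      apply Hs; simpl; try lia; intros E; apply Hne; f_equal; lia.
    + rewrite Cmult_conj, RtoC_mult.
      replace (Cconj (RtoC (r ^ degree q'))) with (RtoC (r ^ degree q'))
        by (apply injective_projections; simpl; ring).
      ring.
  - intros t.
    replace (trig c freq (grid alpha T) t) with (trunc a alpha T (circle r t)).
    + assert (Hc : Cmod (circle r t) = r).
      { unfold circle, Cmod; simpl. pose proof (sin2_cos2 t) as E; unfold Rsqr in E.
        replace (_ + _) with (r ^ 2 * (sin t * sin t + cos t * cos t)) by ring.
        rewrite E, Rmult_1_r. apply sqrt_pow2; lra. }
      set (z := circle r t) in *.
      replace (trunc a alpha T z) with ((trunc a alpha T z - F z) + F z)%C by ring.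
      eapply Rle_trans; [apply Cmod_triangle|].
      specialize (HN T ltac:(lia) z ltac:(lra)).
      specialize (HM z ltac:(unfold disk; lra)). lra.
    + unfold trunc, trig, c. apply sumC_ext; intros q _.
      rewrite monomial_circle. unfold coef, degree. ring. }
rewrite sumR_grid in HB by lia.
pose proof (sumR_term (fun q => Cmod (c q) ^ 2) (higher alpha T) p
  (fun q _ => pow2_ge_0 _) ltac:(apply in_higher; unfold degree in Hdeg; lia)) as Ht.
cbv beta in Ht.
pose proof (pow2_ge_0 (Cmod (c (0, 0)%nat))).
assert (Hc : forall q, Cmod (c q) ^ 2 = Cmod (coef a q) ^ 2 * r ^ (2 * degree q)).
{ intros q; unfold c. rewrite Cmod_mult, Cmod_R, Rabs_pos_eq by (apply pow_le; lra).
  rewrite Rpow_mult_distr, <- pow_mult. do 2 f_equal. lia. }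
rewrite !Hc in *. unfold coef in HB, Ht. simpl fst in *; simpl snd in *.
change (coef a p) with (a (snd p) (fst p)) in *.
(* The linear terms carry the larger power [r ^ 2]. *)
assert (Hd1 : r ^ (2 * degree p) <= r ^ 2).
{ replace (2 * degree p)%nat with (2 + (2 * degree p - 2))%nat by lia.
  rewrite pow_add.
  assert (r ^ (2 * degree p - 2) <= 1)
    by (rewrite <- (pow1 (2 * degree p - 2)); apply pow_incr; lra).
  assert (0 <= r ^ 2) by apply pow2_ge_0. nra. }
unfold degree in HB at 1 2 3. simpl Nat.mul in HB. nra.
Qed.

(** * The terms of degree at least two *)

Lemma Cmod_monomial z p : Cmod (monomial z p) = Cmod z ^ degree p.
Proof.
unfold monomial, degree.
now rewrite Cmod_mult, !Cmod_pow, Cmod_conj, <- pow_add.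
Qed.

Lemma Cpow_lipschitz (r : R) (z w : C) n :
  Cmod z <= r -> Cmod w <= r ->
  Cmod (z ^ n - w ^ n)%C <= INR n * r ^ pred n * Cmod (z - w)%C.
Proof.
intros Hz Hw. pose proof (Cmod_ge_0 z) as Hz0. pose proof (Cmod_ge_0 w) as Hw0.
induction n as [|n IH].
- simpl. replace (1 - 1)%C with (RtoC 0) by ring. rewrite Cmod_0; lra.
- rewrite S_INR, !Cpow_S; simpl pred.
  replace (z * z ^ n - w * w ^ n)%C
    with (z * (z ^ n - w ^ n) + w ^ n * (z - w))%C by ring.
  eapply Rle_trans; [apply Cmod_triangle|]. rewrite !Cmod_mult, Cmod_pow.
  assert (H1 : Cmod w ^ n <= r ^ n) by (apply pow_incr; lra).
  assert (H2 : Cmod z * Cmod (z ^ n - w ^ n)%C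
               <= r * (INR n * r ^ pred n * Cmod (z - w)%C)).
  { apply Rmult_le_compat; trivial; apply Cmod_ge_0. }
  assert (H3 : r * (INR n * r ^ pred n) = INR n * r ^ n).
  { destruct n; simpl; ring. }
  pose proof (Cmod_ge_0 (z - w)%C).
  replace (r * (INR n * r ^ pred n * Cmod (z - w)%C))
    with (INR n * r ^ n * Cmod (z - w)%C) in H2 by (rewrite <- H3; ring).
  nra.
Qed.

(** The derivative bound [(k + n) r^(k + n - 1)] of a monomial, kept split
    into the contributions of its two factors: in this form each row of the grid
    sums to two geometric series. *)
Definition monomial_slope (r : R) (p : nat * nat) : R :=
  INR (snd p) * r ^ pred (snd p) * r ^ fst p
  + INR (fst p) * r ^ pred (fst p) * r ^ snd p.

Lemma monomial_lipschitz (r : R) (z w : C) p :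
  Cmod z <= r -> Cmod w <= r ->
  Cmod (monomial z p - monomial w p)%C <= monomial_slope r p * Cmod (z - w)%C.
Proof.
intros Hz Hw. pose proof (Cmod_ge_0 z) as Hz0. pose proof (Cmod_ge_0 w) as Hw0.
destruct p as [k n]; unfold monomial, monomial_slope; simpl fst; simpl snd.
replace (Cconj z ^ k * z ^ n - Cconj w ^ k * w ^ n)%C
  with (Cconj z ^ k * (z ^ n - w ^ n) + w ^ n * (Cconj z ^ k - Cconj w ^ k))%C
  by ring.
eapply Rle_trans; [apply Cmod_triangle|].
rewrite !Cmod_mult, !Cmod_pow, Cmod_conj.
pose proof (Cpow_lipschitz r z w n Hz Hw) as H1.
pose proof (Cpow_lipschitz r (Cconj z) (Cconj w) k) as H2.
rewrite !Cmod_conj, <- Cminus_conj, Cmod_conj in H2. specialize (H2 Hz Hw).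
rewrite Rmult_plus_distr_r. apply Rplus_le_compat.
- rewrite (Rmult_comm _ (r ^ k)), Rmult_assoc.
  apply Rmult_le_compat; trivial; try apply Cmod_ge_0.
  + now apply pow_le.
  + apply pow_incr; lra.
- rewrite (Rmult_comm _ (r ^ n)), Rmult_assoc.
  apply Rmult_le_compat; trivial; try apply Cmod_ge_0.
  + now apply pow_le.
  + apply pow_incr; lra.
Qed.

(** [height alpha r] and [slope alpha r] are the values at [r] of the sum of
    [r^(k + n)] over all [k < alpha] and all [n], and of its derivative, with
    the geometric series in [n] summed. *)
Definition slope (alpha : nat) (r : R) : R :=
  sumR (fun k => INR k * r ^ pred k / (1 - r) + r ^ k / (1 - r) ^ 2) (seq 0 alpha).

Definition height (alpha : nat) (r : R) : R :=
  sumR (fun k => r ^ k / (1 - r)) (seq 0 alpha).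

Lemma geom_sum_le (r : R) T :
  0 <= r < 1 -> sumR (fun n => r ^ n) (seq 0 T) <= / (1 - r).
Proof.
intros Hr. pose proof (geom_sum r T). assert (0 <= r ^ T) by (apply pow_le; lra).
apply Rmult_le_reg_l with (1 - r); [lra|]. rewrite Rinv_r; lra.
Qed.

Lemma geom_deriv_sum_le (r : R) T :
  0 <= r < 1 ->
  sumR (fun n => INR n * r ^ pred n) (seq 0 T) <= / (1 - r) ^ 2.
Proof.
intros Hr.
assert (E : (1 - r) ^ 2 * sumR (fun n => INR n * r ^ pred n) (seq 0 T)
            = 1 - r ^ T - INR T * r ^ pred T * (1 - r)).
{ induction T as [|T IH]; [simpl; ring|].
  rewrite seq_S, sumR_app, Rmult_plus_distr_l, IH, S_INR.
  simpl sumR. simpl (0 + T)%nat. destruct T as [|T]; [simpl; ring|].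
  simpl pred. rewrite !S_INR. simpl. ring. }
assert (0 < (1 - r) ^ 2) by (apply pow_lt; lra).
assert (0 <= r ^ T) by (apply pow_le; lra).
assert (0 <= INR T * r ^ pred T * (1 - r)).
{ apply Rmult_le_pos; [|lra]. apply Rmult_le_pos; [apply pos_INR | apply pow_le; lra]. }
apply Rmult_le_reg_l with ((1 - r) ^ 2); trivial. rewrite Rinv_r; lra.
Qed.

(** The [2] is the contribution of the two linear monomials. *)
Lemma sumR_monomial_slope_higher alpha T r :
  (2 <= alpha)%nat -> (2 <= T)%nat -> 0 <= r < 1 ->
  sumR (monomial_slope r) (higher alpha T) <= slope alpha r - 2.
Proof.
intros Ha HT Hr.
pose proof (sumR_grid (monomial_slope r) alpha T Ha HT) as E.
assert (H : sumR (monomial_slope r) (grid alpha T) <= slope alpha r).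
{ unfold grid; rewrite sumR_list_prod. apply sumR_le; intros k _.
  unfold monomial_slope; simpl fst; simpl snd.
  rewrite sumR_plus.
  rewrite (sumR_ext _ (fun n => r ^ k * (INR n * r ^ pred n))) by (intros; ring).
  rewrite !sumR_scal, Rplus_comm. unfold Rdiv.
  assert (0 <= r ^ k) by (apply pow_le; lra).
  apply Rplus_le_compat; apply Rmult_le_compat_l; trivial.
  - apply Rmult_le_pos; [apply pos_INR | apply pow_le; lra].
  - now apply geom_sum_le.
  - now apply geom_deriv_sum_le. }
unfold monomial_slope in E at 2 3 4; simpl in E. lra.
Qed.

Lemma sumR_pow_higher alpha T r :
  (2 <= alpha)%nat -> (2 <= T)%nat -> 0 <= r < 1 ->
  sumR (fun p => r ^ degree p) (higher alpha T) <= height alpha r - 1 - 2 * r.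
Proof.
intros Ha HT Hr.
pose proof (sumR_grid (fun p => r ^ degree p) alpha T Ha HT) as E.
assert (H : sumR (fun p => r ^ degree p) (grid alpha T) <= height alpha r).
{ unfold grid; rewrite sumR_list_prod. apply sumR_le; intros k _.
  unfold degree; simpl fst; simpl snd.
  rewrite (sumR_ext _ (fun n => r ^ k * r ^ n)) by (intros; apply pow_add).
  rewrite sumR_scal. unfold Rdiv. apply Rmult_le_compat_l.
  - apply pow_le; lra.
  - now apply geom_sum_le. }
unfold degree in E at 2 3 4; simpl in E. lra.
Qed.

Definition linear_part (b c : C) (z : C) : C := (b * z + c * Cconj z)%C.

Lemma trunc_eq a alpha T z :
  (2 <= alpha)%nat -> (2 <= T)%nat ->
  trunc a alpha T z
  = (a 0%nat 0%nat + linear_part (a 1%nat 0%nat) (a 0%nat 1%nat) z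
     + sumC (fun p => coef a p * monomial z p) (higher alpha T))%C.
Proof.
intros Ha HT; unfold trunc.
rewrite (sumC_perm _ _ _ (grid_perm alpha T Ha HT)).
simpl sumC. unfold monomial at 1 2 3, linear_part; simpl fst; simpl snd; simpl Cpow.
unfold coef. ring.
Qed.

Definition remainder (a : nat -> nat -> C) (F : C -> C) (z : C) : C :=
  (F z - linear_part (a 1%nat 0%nat) (a 0%nat 1%nat) z)%C.

(** A bound on the increments of [sum_(p in higher) coef p * monomial z p]
    which holds for all truncations passes to the limit. *)
Lemma remainder_increment_le a alpha F z w r B :
  (2 <= alpha)%nat -> truncations_converge a alpha F ->
  Cmod z <= r -> Cmod w <= r -> r < 1 ->
  (forall T, (2 <= T)%nat ->
     sumR (fun p => Cmod (coef a p) * Cmod (monomial z p - monomial w p)%C)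
       (higher alpha T) <= B) ->
  Cmod (remainder a F z - remainder a F w)%C <= B.
Proof.
intros Ha HF Hz Hw Hr HB. pose proof (Cmod_ge_0 z).
apply le_epsilon; intros eps He.
destruct (HF r ltac:(lra) (eps / 2) ltac:(lra)) as [N HN].
specialize (HN (N + 2)%nat ltac:(lia)). specialize (HB (N + 2)%nat ltac:(lia)).
pose proof (HN z Hz) as H1. pose proof (HN w Hw) as H2.
rewrite trunc_eq in H1, H2 by (trivial; lia).
set (s := fun u => sumC (fun p => coef a p * monomial u p)%C (higher alpha (N + 2))).
fold (s z) in H1. fold (s w) in H2.
assert (H3 : Cmod (s z - s w)%C <= B).
{ unfold s. rewrite <- sumC_minus. eapply Rle_trans; [apply Cmod_sumC|].
  eapply Rle_trans; [|apply HB]. apply Req_le, sumR_ext; intros p _.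
  rewrite <- Cmod_mult. f_equal. ring. }
unfold remainder. set (L := linear_part _ _) in *. set (a0 := a 0%nat 0%nat) in *.
replace (F z - L z - (F w - L w))%C
  with ((s z - s w) + - (a0 + L z + s z - F z) + (a0 + L w + s w - F w))%C by ring.
eapply Rle_trans; [apply Cmod_triangle|].
eapply Rle_trans; [apply Rplus_le_compat_r, Cmod_triangle|].
rewrite Cmod_opp. lra.
Qed.

Lemma remainder_lipschitz a alpha F K z w r :
  (2 <= alpha)%nat -> truncations_converge a alpha F -> 0 <= K ->
  (forall p, (fst p < alpha)%nat -> (2 <= degree p)%nat -> Cmod (coef a p) <= K) ->
  Cmod z <= r -> Cmod w <= r -> r < 1 ->
  Cmod (remainder a F z - remainder a F w)%C
  <= K * (slope alpha r - 2) * Cmod (z - w)%C.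
Proof.
intros Ha HF HK0 HK Hz Hw Hr. pose proof (Cmod_ge_0 z).
apply (remainder_increment_le a alpha F z w r); trivial; intros T HT.
apply Rle_trans with (sumR (fun p => K * Cmod (z - w)%C * monomial_slope r p)
                        (higher alpha T)).
- apply sumR_le; intros p Hp; apply in_higher in Hp.
  rewrite Rmult_assoc, (Rmult_comm (Cmod (z - w)%C)).
  apply Rmult_le_compat; try apply Cmod_ge_0.
  + apply HK; unfold degree; tauto.
  + now apply monomial_lipschitz.
- rewrite sumR_scal.
  pose proof (sumR_monomial_slope_higher alpha T r Ha HT ltac:(lra)) as Hs.
  assert (HC : 0 <= K * Cmod (z - w)%C)
    by (apply Rmult_le_pos; trivial; apply Cmod_ge_0).
  nra.
Qed.

(** As the remainder vanishes at the origin, its size is an increment. *)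
Lemma remainder_growth a alpha F K z r :
  (2 <= alpha)%nat -> truncations_converge a alpha F -> 0 <= K ->
  (forall p, (fst p < alpha)%nat -> (2 <= degree p)%nat -> Cmod (coef a p) <= K) ->
  F (RtoC 0) = RtoC 0 -> Cmod z <= r -> r < 1 ->
  Cmod (remainder a F z) <= K * (height alpha r - 1 - 2 * r).
Proof.
intros Ha HF HK0 HK HF0 Hz Hr. pose proof (Cmod_ge_0 z).
replace (remainder a F z) with (remainder a F z - remainder a F (RtoC 0))%C.
2:{ unfold remainder at 2; rewrite HF0; unfold linear_part.
    replace (Cconj (RtoC 0)) with (RtoC 0)
      by (apply injective_projections; simpl; ring).
    ring. }
apply (remainder_increment_le a alpha F z 0 r); trivial.
{ rewrite Cmod_0; lra. }
intros T HT.
apply Rle_trans with (sumR (fun p => K * r ^ degree p) (higher alpha T)).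
- apply sumR_le; intros p Hp; apply in_higher in Hp.
  replace (monomial (RtoC 0) p) with (RtoC 0).
  2:{ symmetry; apply Cmod_eq_0. rewrite Cmod_monomial, Cmod_0.
      apply pow_i; unfold degree; lia. }
  replace (monomial z p - 0)%C with (monomial z p) by ring.
  apply Rmult_le_compat; try apply Cmod_ge_0.
  + apply HK; unfold degree; tauto.
  + rewrite Cmod_monomial. apply pow_incr; lra.
- rewrite sumR_scal. apply Rmult_le_compat_l; trivial.
  apply sumR_pow_higher; trivial; lra.
Qed.

(** * The linear part at the origin *)

Lemma slope_closed alpha r :
  (1 <= alpha)%nat -> r <> 1 ->
  slope alpha r
  = (2 + r ^ (alpha - 1) * ((INR alpha - 2) * r - INR alpha)) / (1 - r) ^ 3.
Proof.
intros Ha Hr; destruct alpha as [|m]; [lia|]; clear Ha.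
replace (S m - 1)%nat with m by lia.
induction m as [|m IH].
- unfold slope; simpl; field; lra.
- unfold slope in *. rewrite seq_S, sumR_app, IH.
  cbn [sumR fold_right Nat.add Nat.pred].
  rewrite !S_INR, <- !tech_pow_Rmult. field; lra.
Qed.

Lemma height_closed alpha r :
  r <> 1 -> height alpha r = (1 - r ^ alpha) / (1 - r) ^ 2.
Proof.
intros Hr; unfold height.
rewrite (sumR_ext _ (fun k => / (1 - r) * r ^ k)) by (intros; unfold Rdiv; ring).
rewrite (sumR_scal (/ (1 - r)) (fun k => r ^ k)), <- geom_sum. field; lra.
Qed.

Lemma continuity_pt_slope alpha r :
  (1 <= alpha)%nat -> r < 1 -> continuity_pt (slope alpha) r.
Proof.
intros Ha Hr.
apply (continuity_pt_ext_loc
  (fun r => (2 + r ^ (alpha - 1) * ((INR alpha - 2) * r - INR alpha)) / (1 - r) ^ 3)).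
- exists (mkposreal (1 - r) ltac:(lra)); intros y Hy.
  symmetry; apply slope_closed; trivial.
  apply Rabs_lt_between' in Hy; simpl in Hy; lra.
- apply continuity_pt_filterlim.
  refine (ex_derive_continuous (K := R_AbsRing) (V := R_NormedModule) _ r _).
  auto_derive. apply (pow_nonzero (1 - r) 3); lra.
Qed.

(** At radius zero only the two linear monomials have a nonzero slope, which is
    why the remainder is infinitesimal there. *)
Lemma slope_0 alpha : (2 <= alpha)%nat -> slope alpha 0 = 2.
Proof.
intros Ha; rewrite slope_closed by (lia || lra).
rewrite pow_i by lia; field.
Qed.

Lemma remainder_little_o a alpha F K :
  (2 <= alpha)%nat -> truncations_converge a alpha F -> 0 <= K ->
  (forall p, (fst p < alpha)%nat -> (2 <= degree p)%nat -> Cmod (coef a p) <= K) ->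
  F (RtoC 0) = RtoC 0 ->
  forall eps, 0 < eps -> exists delta, 0 < delta /\
    forall z, Cmod z < delta -> Cmod (remainder a F z) <= eps * Cmod z.
Proof.
intros Ha HF HK0 HK HF0 eps He.
pose proof (continuity_pt_slope alpha 0 ltac:(lia) ltac:(lra)) as Hc.
destruct (Hc (eps / (K + 1)) ltac:(apply Rdiv_lt_0_compat; lra))
  as [d [Hd Hs]].
set (delta := Rmin (d / 2) (1 / 2)).
assert (Hd1 : 0 < delta) by (apply Rmin_pos; lra).
assert (Hd2 : delta <= d / 2) by apply Rmin_l.
assert (Hd3 : delta <= 1 / 2) by apply Rmin_r.
exists delta; split; trivial; intros z Hz.
replace (remainder a F z) with (remainder a F z - remainder a F (RtoC 0))%C.
2:{ unfold remainder at 2; rewrite HF0; unfold linear_part.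
    replace (Cconj (RtoC 0)) with (RtoC 0)
      by (apply injective_projections; simpl; ring).
    ring. }
assert (Hs' : slope alpha delta - 2 <= eps / (K + 1)).
{ specialize (Hs delta). simpl in Hs. unfold R_dist, D_x, no_cond in Hs.
  rewrite slope_0 in Hs by trivial.
  assert (HA : Rabs (slope alpha delta - 2) < eps / (K + 1)).
  { apply Hs. repeat split; try lra. rewrite Rabs_pos_eq; lra. }
  apply Rabs_lt_between in HA; lra. }
eapply Rle_trans.
- apply (remainder_lipschitz a alpha F K z 0 delta); trivial; try lra.
  rewrite Cmod_0; lra.
- replace (z - 0)%C with z by ring. apply Rmult_le_compat_r; [apply Cmod_ge_0|].
  assert (E : eps / (K + 1) * (K + 1) = eps) by (field; lra).
  assert (0 < eps / (K + 1)) by (apply Rdiv_lt_0_compat; lra). nra.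
Qed.

Lemma derive_0_of_little_o (f : R -> R) (l : R) :
  f 0 = 0 ->
  (forall eps, 0 < eps -> exists delta, 0 < delta /\
     forall t, Rabs t < delta -> Rabs (f t - l * t) <= eps * Rabs t) ->
  Derive f 0 = l.
Proof.
intros Hf0 H; apply is_derive_unique, is_derive_Reals.
intros eps He. destruct (H (eps / 2) ltac:(lra)) as [d [Hd Hd']].
exists (mkposreal d Hd); simpl; intros h Hh Hhd.
rewrite Rplus_0_l, Hf0.
replace ((f h - 0) / h - l) with ((f h - l * h) * / h) by (field; trivial).
rewrite Rabs_mult, Rabs_inv.
specialize (Hd' h Hhd). pose proof (Rabs_pos_lt h Hh) as Hp.
apply Rle_lt_trans with (eps / 2 * Rabs h * / Rabs h).
- apply Rmult_le_compat_r; trivial. left; now apply Rinv_0_lt_compat.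
- rewrite Rmult_assoc, Rinv_r; lra.
Qed.

Lemma im_le_Cmod z : Rabs (Im z) <= Cmod z.
Proof. eapply Rle_trans; [apply Rmax_r | apply (Rmax_Cmod z)]. Qed.

(** The linear part is the differential at the origin, and its two coefficients
    are its Wirtinger derivatives. *)
Lemma partial_0 a F :
  F (RtoC 0) = RtoC 0 ->
  (forall eps, 0 < eps -> exists delta, 0 < delta /\
     forall z, Cmod z < delta -> Cmod (remainder a F z) <= eps * Cmod z) ->
  partial_z F (RtoC 0) = a 1%nat 0%nat /\ partial_zbar F (RtoC 0) = a 0%nat 1%nat.
Proof.
intros HF0 H.
assert (Hx : forall t, Cmod (t, 0) = Rabs t) by (intros t; apply (Cmod_R t)).
assert (Hy : forall t, Cmod (0, t) = Rabs t).
{ intros t. rewrite <- (Cmod_R t), <- (Rmult_1_l (Cmod t)), <- Cmod_Ci, <- Cmod_mult.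
  f_equal. apply injective_projections; simpl; ring. }
set (b := a 1%nat 0%nat) in *; set (c := a 0%nat 1%nat) in *.
assert (Px : partial_x F (RtoC 0) = (b + c)%C).
{ unfold partial_x; apply injective_projections; simpl;
    apply derive_0_of_little_o.
  1, 3: change (0, 0) with (RtoC 0); rewrite HF0; reflexivity.
  all: intros eps He; destruct (H eps He) as [d [Hd Hd']];
    exists d; split; trivial; intros t Ht;
    specialize (Hd' (t, 0)); rewrite Hx in Hd'; specialize (Hd' Ht);
    refine (Rle_trans _ _ _ _ Hd').
  - eapply Rle_trans; [|apply re_le_Cmod]. apply Req_le; f_equal.
    unfold remainder, linear_part, Re; fold b c; simpl; ring.
  - eapply Rle_trans; [|apply im_le_Cmod]. apply Req_le; f_equal.
    unfold remainder, linear_part, Im; fold b c; simpl; ring. }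
assert (Py : partial_y F (RtoC 0) = (Ci * (b - c))%C).
{ unfold partial_y; apply injective_projections; simpl;
    apply derive_0_of_little_o.
  1, 3: change (0, 0) with (RtoC 0); rewrite HF0; reflexivity.
  all: intros eps He; destruct (H eps He) as [d [Hd Hd']];
    exists d; split; trivial; intros t Ht;
    specialize (Hd' (0, t)); rewrite Hy in Hd'; specialize (Hd' Ht);
    refine (Rle_trans _ _ _ _ Hd').
  - eapply Rle_trans; [|apply re_le_Cmod]. apply Req_le; f_equal.
    unfold remainder, linear_part, Re; fold b c; simpl; ring.
  - eapply Rle_trans; [|apply im_le_Cmod]. apply Req_le; f_equal.
    unfold remainder, linear_part, Im; fold b c; simpl; ring. }
unfold partial_z, partial_zbar; rewrite Px, Py.
split; apply injective_projections; simpl; field.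
Qed.

Lemma linear_part_minus b c u v :
  (linear_part b c u - linear_part b c v)%C = linear_part b c (u - v).
Proof. unfold linear_part; rewrite Cminus_conj; ring. Qed.

Lemma linear_part_expanding b c u :
  Rabs (Cmod b - Cmod c) * Cmod u <= Cmod (linear_part b c u).
Proof.
rewrite <- (Rabs_pos_eq (Cmod u)) at 1 by apply Cmod_ge_0.
rewrite <- Rabs_mult, Rmult_minus_distr_r, <- Cmod_mult.
rewrite <- (Cmod_conj u). rewrite <- Cmod_mult. unfold linear_part.
set (p := (b * u)%C); set (q := (c * Cconj u)%C).
pose proof (Cmod_triangle (p + q) (- q)) as H1.
pose proof (Cmod_triangle (p + q) (- p)) as H2.
rewrite Cmod_opp in H1, H2.
replace (p + q + - q)%C with p in H1 by ring.
replace (p + q + - p)%C with q in H2 by ring.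
apply Rabs_le; lra.
Qed.

(** The inverse is [u |-> (Cconj b * u - c * Cconj u) / (|b|^2 - |c|^2)]; it is
    nonexpanding because the map itself shortens no distance. *)
Lemma linear_part_inverse b c :
  Rabs (Cmod b - Cmod c) = 1 ->
  exists Li : C -> C, (forall u, linear_part b c (Li u) = u) /\
    (forall u v, Cmod (Li u - Li v)%C <= Cmod (u - v)%C).
Proof.
intros H.
assert (Hd : Cmod b ^ 2 - Cmod c ^ 2 <> 0).
{ replace (Cmod b ^ 2 - Cmod c ^ 2)
    with ((Cmod b - Cmod c) * (Cmod b + Cmod c)) by ring.
  pose proof (Cmod_ge_0 b); pose proof (Cmod_ge_0 c).
  apply Rmult_integral_contrapositive; split.
  - intros E; rewrite E, Rabs_R0 in H; lra.
  - intros E. replace (Cmod b) with 0 in H by lra. replace (Cmod c) with 0 in H by lra.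
    rewrite Rminus_0_r, Rabs_R0 in H; lra. }
set (Li := fun u => (RtoC (/ (Cmod b ^ 2 - Cmod c ^ 2)) * (Cconj b * u - c * Cconj u))%C).
assert (HL : forall u, linear_part b c (Li u) = u).
{ intros u; unfold Li, linear_part.
  set (s := / _).
  assert (E : (RtoC s * (b * Cconj b - c * Cconj c))%C = RtoC 1).
  { rewrite <- !Cmod2_conj, <- RtoC_minus, <- RtoC_mult. f_equal. unfold s; field; trivial. }
  rewrite Cmult_conj, Cminus_conj, !Cmult_conj, !Cconj_conj.
  replace (Cconj (RtoC s)) with (RtoC s)
    by (apply injective_projections; simpl; ring).
  transitivity (RtoC s * (b * Cconj b - c * Cconj c) * u)%C; [ring | rewrite E; ring]. }
exists Li; split; trivial; intros u v.
rewrite <- (HL u) at 2. rewrite <- (HL v) at 2. rewrite linear_part_minus.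
pose proof (linear_part_expanding b c (Li u - Li v)). rewrite H in *. lra.
Qed.

(** * The critical radius *)

(** Every row increases with the radius, and the row [k = 0], which
    is [1 / (1 - r)^2], does so strictly. *)
Lemma slope_increasing alpha r s :
  (1 <= alpha)%nat -> 0 <= r < s -> s < 1 -> slope alpha r < slope alpha s.
Proof.
intros Ha Hr Hs; destruct alpha as [|m]; [lia|].
assert (Hi1 : / (1 - r) <= / (1 - s)) by (apply Rinv_le_contravar; lra).
assert (Hi0 : 0 < / (1 - r)) by (apply Rinv_0_lt_compat; lra).
unfold slope; cbn [seq sumR fold_right].
apply Rplus_lt_le_compat.
- simpl. unfold Rdiv; rewrite !Rmult_0_l, !Rplus_0_l, !Rmult_1_l, !Rmult_1_r.
  apply Rinv_lt_contravar; [|nra].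
  apply Rmult_lt_0_compat; apply Rmult_lt_0_compat; lra.
- apply sumR_le; intros k _. unfold Rdiv; rewrite <- !pow_inv.
  assert (Hp : forall j, 0 <= r ^ j <= s ^ j).
  { intros j; split; [apply pow_le | apply pow_incr]; lra. }
  apply Rplus_le_compat; apply Rmult_le_compat; try (apply Hp || lra).
  + apply Rmult_le_pos; [apply pos_INR | apply Hp].
  + apply Rmult_le_compat_l; [apply pos_INR | apply Hp].
  + apply pow_le; lra.
  + apply pow_incr; lra.
Qed.

Lemma slope_ge alpha r : (1 <= alpha)%nat -> 0 <= r < 1 -> / (1 - r) <= slope alpha r.
Proof.
intros Ha Hr; destruct alpha as [|m]; [lia|].
assert (Hi : 1 <= / (1 - r)).
{ rewrite <- Rinv_1 at 1. apply Rinv_le_contravar; lra. }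
unfold slope; cbn [seq sumR fold_right].
match goal with |- _ <= _ + ?s => assert (0 <= s) end.
{ apply sumR_nonneg; intros k _. unfold Rdiv; rewrite <- !pow_inv.
  apply Rplus_le_le_0_compat; repeat apply Rmult_le_pos;
    try apply pos_INR; try apply pow_le; lra. }
apply Rle_trans with (/ (1 - r) ^ 2).
- rewrite <- pow_inv; simpl; nra.
- unfold Rdiv; simpl in *; lra.
Qed.

(** [K (slope - 2)] runs from [0] to infinity on [[0, 1)]; the proof evaluates
    it at [1 - d] with [d = 1 / (3 + 1 / K)], where the bound [slope >= 1 / d]
    already gives a value above [1]. *)
Lemma critical_radius alpha K :
  (2 <= alpha)%nat -> 0 < K ->
  exists r, 0 < r < 1 /\ K * (slope alpha r - 2) = 1.
Proof.
intros Ha HK.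
set (f := fun r => K * (slope alpha r - 2) - 1).
set (d := / (3 + / K)).
assert (HK' : 0 < / K) by (now apply Rinv_0_lt_compat).
assert (Hd : 0 < d) by (apply Rinv_0_lt_compat; lra).
assert (Hd1 : d < 1).
{ unfold d; rewrite <- Rinv_1. apply Rinv_lt_contravar; lra. }
assert (Hf0 : f 0 < 0) by (unfold f; rewrite slope_0 by trivial; lra).
assert (Hf1 : 0 < f (1 - d)).
{ unfold f. pose proof (slope_ge alpha (1 - d) ltac:(lia) ltac:(lra)) as H.
  replace (1 - (1 - d)) with d in H by ring. unfold d at 1 in H.
  rewrite Rinv_inv in H.
  assert (K * / K = 1) by (field; lra). nra. }
destruct (IVT_interv f 0 (1 - d)) as [r [Hr Hfr]]; trivial; try lra.
- intros x Hx. unfold f.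
  apply continuity_pt_minus; [|apply continuity_pt_const; now intros ? ?].
  apply continuity_pt_scal, continuity_pt_minus;
    [|apply continuity_pt_const; now intros ? ?].
  apply continuity_pt_slope; lia || lra.
- exists r; repeat split; try lra.
  + destruct (Rle_lt_or_eq_dec 0 r) as [H|H]; try lra. rewrite <- H in Hfr; lra.
  + unfold f in Hfr; lra.
Qed.

Lemma is_derive_height alpha r :
  r < 1 -> is_derive (height alpha) r (slope alpha r).
Proof.
intros Hr. unfold height, slope. induction (seq 0 alpha) as [|k l IH]; simpl.
- apply (@is_derive_const R_AbsRing R_NormedModule).
- apply (@is_derive_plus R_AbsRing R_NormedModule); trivial.
  auto_derive; [lra|]. simpl; field; lra.
Qed.

(** A lower bound for [|F|] on the circle of radius [r]: the linear part has
    modulus at least [r], from which the growth of the remainder is subtracted.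
    Its derivative in [r] is [1 - K (slope - 2)], the factor by
    which [F] stretches distances at least. *)
Definition schlicht_radius (alpha : nat) (K r : R) : R :=
  r - K * (height alpha r - 1 - 2 * r).

Lemma derivable_schlicht_radius alpha K r :
  r < 1 ->
  derivable_pt_lim (schlicht_radius alpha K) r (1 - K * (slope alpha r - 2)).
Proof.
intros Hr; apply is_derive_Reals. unfold schlicht_radius.
pose proof (is_derive_height alpha r Hr) as H.
auto_derive.
- now exists (slope alpha r).
- replace (Derive _ r) with (slope alpha r) by (symmetry; now apply is_derive_unique).
  ring.
Qed.

Lemma height_0 alpha : (1 <= alpha)%nat -> height alpha 0 = 1.
Proof. intros Ha. rewrite height_closed by lra. rewrite pow_i by lia. field. Qed.

(** It vanishes at [0] and increases up to the critical radius. *)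
Lemma schlicht_radius_pos alpha K r :
  (2 <= alpha)%nat -> 0 < K -> 0 < r < 1 -> K * (slope alpha r - 2) = 1 ->
  0 < schlicht_radius alpha K r.
Proof.
intros Ha HK Hr Hroot.
destruct (MVT_cor2 (schlicht_radius alpha K)
            (fun c => 1 - K * (slope alpha c - 2)) 0 r) as [c [E Hc]]; [lra| |].
- intros c Hc; apply derivable_schlicht_radius; lra.
- replace (schlicht_radius alpha K 0) with 0 in E
    by (unfold schlicht_radius; rewrite height_0 by lia; ring).
  pose proof (slope_increasing alpha c r ltac:(lia) ltac:(lra) ltac:(lra)).
  assert (0 < (1 - K * (slope alpha c - 2)) * (r - 0)); [|lra].
  apply Rmult_lt_0_compat; [nra | lra].
Qed.

(** The contraction argument needs radii strictly below the critical one, and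
    loses no value strictly below the limit. *)
Lemma schlicht_radius_approach alpha K r rho :
  0 < r < 1 -> rho < schlicht_radius alpha K r ->
  exists s, 0 <= s < r /\ rho <= schlicht_radius alpha K s.
Proof.
intros Hr Hrho.
assert (Hc : continuity_pt (schlicht_radius alpha K) r).
{ apply derivable_continuous_pt. eexists. apply derivable_schlicht_radius; lra. }
destruct (Hc (schlicht_radius alpha K r - rho) ltac:(lra)) as [d [Hd H]].
set (h := Rmin (d / 2) (r / 2)).
assert (0 < h) by (apply Rmin_pos; lra).
assert (h <= d / 2) by apply Rmin_l. assert (h <= r / 2) by apply Rmin_r.
exists (r - h); split; [lra|].
specialize (H (r - h)). simpl in H; unfold R_dist, D_x, no_cond in H.
assert (HA : Rabs (schlicht_radius alpha K (r - h) - schlicht_radius alpha K r)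
             < schlicht_radius alpha K r - rho).
{ apply H; repeat split; try lra. rewrite Rabs_left; lra. }
apply Rabs_lt_between in HA; lra.
Qed.

Lemma radius_equation alpha K r :
  (1 <= alpha)%nat -> r <> 1 ->
  1 + K - K / (1 - r) ^ 3 *
    (r * (2 - r) * (1 - r) + 1 + r
     + r ^ (alpha - 1) * ((INR alpha - 2) * r - INR alpha))
  = 1 - K * (slope alpha r - 2).
Proof. intros Ha Hr; rewrite slope_closed by trivial. field; lra. Qed.

Lemma schlicht_radius_closed alpha K r :
  (2 <= alpha)%nat -> r <> 1 ->
  r - K * (2 * r ^ 2 * (1 - r ^ (alpha - 2)) / (1 - r) + r ^ alpha
           + r ^ 2 * (1 - r ^ alpha) / (1 - r) ^ 2)
  = schlicht_radius alpha K r.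
Proof.
intros Ha Hr; unfold schlicht_radius; rewrite height_closed by trivial.
destruct alpha as [|[|m]]; try lia.
replace (S (S m) - 2)%nat with m by lia. rewrite <- !tech_pow_Rmult. field; lra.
Qed.

Lemma least_positive_root_critical alpha K r :
  (2 <= alpha)%nat -> 0 < K -> 0 < r < 1 -> K * (slope alpha r - 2) = 1 ->
  least_positive_root
    (fun r => 1 + K - K / (1 - r) ^ 3 *
       (r * (2 - r) * (1 - r) + 1 + r
        + r ^ (alpha - 1) * ((INR alpha - 2) * r - INR alpha))) r.
Proof.
intros Ha HK Hr Hroot; split; [lra|split].
- rewrite radius_equation by (lia || lra). lra.
- intros t Ht E. destruct (Rle_lt_dec r t) as [|Htr]; trivial.
  rewrite radius_equation in E by (lia || lra).
  pose proof (slope_increasing alpha t r ltac:(lia) ltac:(lra) ltac:(lra)). nra.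
Qed.

(** * Schlicht disks of perturbed linear maps *)

(** Open sets are defined by boxes; this and the next lemma pass between boxes
    and Euclidean disks, at the cost of the factor [sqrt 2 < 2]. *)
Lemma open_of_Cmod (U : C -> Prop) :
  (forall z, U z -> exists d, 0 < d /\ forall w, Cmod (w - z)%C < d -> U w) ->
  open U.
Proof.
intros H z Hz; destruct (H z Hz) as [d [Hd Hw]].
exists (mkposreal (d / 2) ltac:(lra)); intros w Hb; apply Hw.
pose proof (C_NormedModule_mixin_compat2 z w _ Hb) as H1.
change (Cmod (w - z)%C < sqrt 2 * (d / 2)) in H1.
assert (sqrt 2 < 2) by (rewrite <- (sqrt_pow2 2) at 2 by lra; apply sqrt_lt_1; lra).
nra.
Qed.

Lemma Cmod_of_open (U : C -> Prop) (z : C) :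
  open U -> U z -> exists d, 0 < d /\ forall w, Cmod (w - z)%C < d -> U w.
Proof.
intros H Hz; destruct (H z Hz) as [[d Hd] Hw]; exists d; split; trivial.
intros w Hwz; apply Hw. now apply C_NormedModule_mixin_compat1.
Qed.

(** Banach's theorem on a closed disk.  The orbit of [0] is the sequence of
    partial sums of its increments, which a geometric series dominates. *)
Lemma contraction_fixed_point (Phi : C -> C) (r q : R) :
  0 <= r -> 0 <= q < 1 ->
  (forall z, Cmod z <= r -> Cmod (Phi z) <= r) ->
  (forall z w, Cmod z <= r -> Cmod w <= r ->
     Cmod (Phi z - Phi w)%C <= q * Cmod (z - w)%C) ->
  exists z, Cmod z <= r /\ Phi z = z.
Proof.
intros Hr Hq Hmap Hlip.
set (x := fix x n := match n with O => RtoC 0 | S n => Phi (x n) end).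
assert (Hx : forall n, Cmod (x n) <= r).
{ induction n as [|n IH]; [simpl; rewrite Cmod_0; lra | now apply Hmap]. }
set (u := fun n => (x (S n) - x n)%C).
assert (Hu : forall n, Cmod (u n) <= Cmod (u 0%nat) * q ^ n).
{ induction n as [|n IH]; [simpl; lra|].
  apply Rle_trans with (q * Cmod (u n)).
  - apply (Hlip (x (S n)) (x n)); apply Hx.
  - simpl; nra. }
assert (Hs : @ex_series C_AbsRing C_NormedModule u).
{ apply (@ex_series_le C_AbsRing C_CompleteNormedModule u _ Hu).
  apply (@ex_series_scal_l R_AbsRing), ex_series_geom. rewrite Rabs_pos_eq; lra. }
destruct Hs as [l Hl].
assert (Hlim : forall eps, 0 < eps -> exists n, Cmod (x n - l)%C < eps /\
                 Cmod (x (S n) - l)%C < eps).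
{ intros eps He.
  destruct (proj1 (filterlim_locally_ball_norm _ _) Hl (mkposreal eps He)) as [N HN].
  assert (E : forall n, @sum_n C_AbelianGroup u n = x (S n)).
  { induction n as [|n IH].
    - rewrite sum_O; unfold u. change (x 1%nat - 0 = x 1%nat)%C. ring.
    - rewrite sum_Sn, IH; unfold u.
      change (x (S n) + (x (S (S n)) - x (S n)) = x (S (S n)))%C. ring. }
  exists (S N). split.
  - specialize (HN N ltac:(lia)).
    change (Cmod (@sum_n C_AbelianGroup u N - l)%C < eps) in HN.
    now rewrite E in HN.
  - specialize (HN (S N) ltac:(lia)).
    change (Cmod (@sum_n C_AbelianGroup u (S N) - l)%C < eps) in HN.
    now rewrite E in HN. }
assert (Hlr : Cmod l <= r).
{ apply le_epsilon; intros eps He. destruct (Hlim eps He) as [n [H1 _]].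
  replace l with (x n + - (x n - l))%C by ring.
  eapply Rle_trans; [apply Cmod_triangle|]. rewrite Cmod_opp.
  specialize (Hx n). lra. }
exists l; split; trivial.
apply Ceq_minus, Cmod_eq_0, Rle_antisym; [|apply Cmod_ge_0].
apply le_epsilon; intros eps He.
destruct (Hlim (eps / 2) ltac:(lra)) as [n [H1 H2]].
replace (Phi l - l)%C with (- (Phi (x n) - Phi l) + (x (S n) - l))%C
  by (simpl; ring).
eapply Rle_trans; [apply Cmod_triangle|]. rewrite Cmod_opp.
specialize (Hlip (x n) l (Hx n) Hlr). pose proof (Cmod_ge_0 (x n - l)%C). nra.
Qed.

(** Consider the supremum [s] of the times at which the path is in [V]: if
    [g s] is in [V], openness contradicts the choice of [s] unless [s = 1],
    and if it is in [W], times close to [s] are in both sets. *)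
Lemma path_meets_both (g : R -> C) (k : R) (V W : C -> Prop) :
  (forall s t, 0 <= s <= 1 -> 0 <= t <= 1 ->
     Cmod (g s - g t)%C <= k * Rabs (s - t)) ->
  open V -> open W -> (forall t, 0 <= t <= 1 -> V (g t) \/ W (g t)) ->
  V (g 0) -> W (g 1) ->
  exists t, 0 <= t <= 1 /\ V (g t) /\ W (g t).
Proof.
intros Hg HV HW Hcov H0 H1.
assert (Hk : 0 <= k).
{ specialize (Hg 1 0 ltac:(lra) ltac:(lra)). pose proof (Cmod_ge_0 (g 1 - g 0)%C).
  rewrite Rminus_0_r, Rabs_R1 in Hg. lra. }
assert (Hnear : forall s d, 0 <= s <= 1 -> 0 < d -> exists h, 0 < h /\
          forall t, 0 <= t <= 1 -> Rabs (t - s) < h -> Cmod (g t - g s)%C < d).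
{ intros s d Hs Hd. exists (d / (k + 1)).
  split; [apply Rdiv_lt_0_compat; lra|]. intros t Ht Hts.
  eapply Rle_lt_trans; [apply Hg; trivial|].
  assert (Rabs (t - s) * (k + 1) < d).
  { replace d with (d / (k + 1) * (k + 1)) by (field; lra).
    apply Rmult_lt_compat_r; lra. }
  pose proof (Rabs_pos (t - s)). nra. }
destruct (completeness (fun t => 0 <= t <= 1 /\ V (g t))) as [s [Hub Hlub]].
- exists 1; intros t [Ht _]; lra.
- exists 0; split; trivial; lra.
- assert (Hs : 0 <= s <= 1).
  { split; [apply Hub; split; trivial; lra | apply Hlub; intros t [Ht _]; lra]. }
  destruct (Hcov s Hs) as [Vs|Ws].
  + destruct (Req_dec s 1) as [->|Hs1]; [exists 1; auto|].
    destruct (Cmod_of_open V _ HV Vs) as [d [Hd HdV]].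
    destruct (Hnear s d Hs Hd) as [h [Hh Hhd]].
    set (t := Rmin 1 (s + h / 2)).
    assert (t <= 1) by apply Rmin_l. assert (t <= s + h / 2) by apply Rmin_r.
    assert (s < t) by (apply Rmin_glb_lt; lra).
    assert (t <= s); [|lra].
    apply Hub; split; [lra|]. apply HdV, Hhd; [lra|]. rewrite Rabs_pos_eq; lra.
  + destruct (Cmod_of_open W _ HW Ws) as [d [Hd HdW]].
    destruct (Hnear s d Hs Hd) as [h [Hh Hhd]].
    destruct (classic (exists t, (0 <= t <= 1 /\ V (g t)) /\ s - h < t))
      as [[t [[Ht Vt] Hst]]|Hno].
    * exists t; repeat split; try apply Ht; trivial.
      apply HdW, Hhd; trivial. assert (t <= s) by (apply Hub; auto).
      apply Rabs_lt_between; lra.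
    * assert (s <= s - h); [|lra].
      apply Hlub; intros t Ht. apply Rnot_lt_le; intros Hst. apply Hno; eauto.
Qed.

Lemma connected_of_paths (U : C -> Prop) (z0 : C) :
  (forall z, U z -> exists (g : R -> C) (k : R),
     g 0 = z0 /\ g 1 = z /\ (forall t, 0 <= t <= 1 -> U (g t)) /\
     (forall s t, 0 <= s <= 1 -> 0 <= t <= 1 ->
        Cmod (g s - g t)%C <= k * Rabs (s - t))) ->
  connected U.
Proof.
intros H V W HV HW Hcov [z1 [U1 V1]] [z2 [U2 W2]].
destruct (H z1 U1) as (g1 & k1 & Hg10 & Hg11 & Hg1U & Hg1).
destruct (H z2 U2) as (g2 & k2 & Hg20 & Hg21 & Hg2U & Hg2).
assert (U0 : U z0) by (rewrite <- Hg10; apply Hg1U; lra).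
destruct (Hcov z0 U0) as [V0|W0].
- destruct (path_meets_both g2 k2 V W) as [t [Ht [Vt Wt]]]; trivial; try congruence.
  + intros t Ht; auto.
  + exists (g2 t); auto.
- destruct (path_meets_both g1 k1 W V) as [t [Ht [Vt Wt]]]; trivial; try congruence.
  + intros t Ht; destruct (Hcov (g1 t)); auto.
  + exists (g1 t); auto.
Qed.

(** The linear part stretches distances by at least [1], and the perturbation
    by less than [1], so [F] stretches distances by a positive factor on every
    smaller disk.  This gives univalence, and makes the local inverses
    Lipschitz.  By the growth condition, [z |-> L^-1 (v - (F z - L z))]
    maps a smaller closed disk into itself for every [v] of modulus below
    [sigma], and it contracts; its fixed point is a preimage of [v].  The
    preimage of the disk of radius [sigma] is open by continuity of [F], and is
    connected because the segment from [0] to [F z] lifts to a path from [0]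
    to [z]. *)
Lemma perturbed_linear_schlicht (F : C -> C) (b c : C) (r0 sigma : R) :
  Rabs (Cmod b - Cmod c) = 1 -> 0 < r0 -> 0 < sigma ->
  F (RtoC 0) = RtoC 0 ->
  (forall r, 0 <= r < r0 -> exists q, 0 <= q < 1 /\
     forall z w, Cmod z <= r -> Cmod w <= r ->
       Cmod ((F z - linear_part b c z) - (F w - linear_part b c w))%C
       <= q * Cmod (z - w)%C) ->
  (forall rho, 0 <= rho < sigma -> exists r, 0 <= r < r0 /\
     forall z, Cmod z <= r -> rho + Cmod (F z - linear_part b c z)%C <= r) ->
  univalent_on F (disk r0) /\ contains_schlicht_disk F (disk r0) sigma.
Proof.
intros Hbc Hr0 Hsig HF0 Hlip Hgrow.
assert (Hexp : forall r, 0 <= r < r0 -> exists q, 0 < q /\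
          forall z w, Cmod z <= r -> Cmod w <= r ->
          q * Cmod (z - w)%C <= Cmod (F z - F w)%C).
{ intros r Hr. destruct (Hlip r Hr) as [q [Hq Hl]]. exists (1 - q).
  split; [lra|]; intros z w Hz Hw. specialize (Hl z w Hz Hw).
  pose proof (linear_part_expanding b c (z - w)) as HL.
  rewrite Hbc, Rmult_1_l, <- linear_part_minus in HL.
  set (Lz := linear_part b c z) in *. set (Lw := linear_part b c w) in *.
  replace (Lz - Lw)%C with (- (F z - Lz - (F w - Lw)) + (F z - F w))%C in HL by ring.
  pose proof (Cmod_triangle (- (F z - Lz - (F w - Lw))) (F z - F w)) as HT.
  rewrite Cmod_opp in HT. lra. }
assert (Hmax : forall z w, disk r0 z -> disk r0 w -> exists r, 0 <= r < r0 /\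
          Cmod z <= r /\ Cmod w <= r).
{ unfold disk; intros z w Hz Hw. exists (Rmax (Cmod z) (Cmod w)).
  pose proof (Rmax_l (Cmod z) (Cmod w)). pose proof (Rmax_r (Cmod z) (Cmod w)).
  pose proof (Cmod_ge_0 z).
  repeat split; trivial; try lra. now apply Rmax_lub_lt. }
assert (Huni : univalent_on F (disk r0)).
{ intros z w Hz Hw E. destruct (Hmax z w Hz Hw) as [r [Hr [Hzr Hwr]]].
  destruct (Hexp r Hr) as [q [Hq Hqr]]. specialize (Hqr z w Hzr Hwr).
  rewrite E in Hqr. replace (F w - F w)%C with (RtoC 0) in Hqr by ring.
  rewrite Cmod_0 in Hqr. pose proof (Cmod_ge_0 (z - w)%C).
  apply Ceq_minus, Cmod_eq_0. nra. }
split; trivial.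
destruct (linear_part_inverse b c Hbc) as [Li [HLi HLiL]].
assert (Hsol : forall rho, 0 <= rho < sigma -> exists r, 0 <= r < r0 /\
          forall v, Cmod v <= rho -> exists z, Cmod z <= r /\ F z = v).
{ intros rho Hrho. destruct (Hgrow rho Hrho) as [r [Hr Hgr]].
  exists r; split; trivial; intros v Hv.
  destruct (Hlip r Hr) as [q [Hq Hl]].
  assert (HLi0 : Li (RtoC 0) = RtoC 0).
  { pose proof (linear_part_expanding b c (Li 0)) as H.
    rewrite HLi, Hbc, Cmod_0 in H. apply Cmod_eq_0.
    pose proof (Cmod_ge_0 (Li 0)). lra. }
  destruct (contraction_fixed_point
              (fun z => Li (v - (F z - linear_part b c z))%C) r q)
    as [z [Hz Hfix]]; trivial; try lra.
  - intros z Hz. specialize (HLiL (v - (F z - linear_part b c z))%C 0).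
    rewrite HLi0 in HLiL.
    replace (Li (v - (F z - linear_part b c z)) - 0)%C
      with (Li (v - (F z - linear_part b c z))%C) in HLiL by ring.
    eapply Rle_trans; [apply HLiL|].
    replace (v - (F z - linear_part b c z) - 0)%C
      with (v + - (F z - linear_part b c z))%C by ring.
    eapply Rle_trans; [apply Cmod_triangle|]. rewrite Cmod_opp.
    specialize (Hgr z Hz). lra.
  - intros z w Hz Hw. eapply Rle_trans; [apply HLiL|].
    rewrite <- Cmod_opp. refine (Rle_trans _ _ _ (Req_le _ _ _) (Hl z w Hz Hw)).
    f_equal; ring.
  - exists z; split; trivial.
    pose proof (HLi (v - (F z - linear_part b c z))%C) as H. rewrite Hfix in H.
    replace (F z) with (linear_part b c z + (F z - linear_part b c z))%C by ring.
    rewrite H at 1. ring. }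
exists (fun z => disk r0 z /\ Cmod (F z) < sigma).
assert (U0 : disk r0 0 /\ Cmod (F 0) < sigma).
{ rewrite HF0; unfold disk; rewrite Cmod_0; lra. }
split; [split; [|split] | split; [|split]].
- now exists (RtoC 0).
- apply open_of_Cmod. intros z [Hz HFz]. unfold disk in Hz.
  set (r := (Cmod z + r0) / 2). pose proof (Cmod_ge_0 z) as Hz0.
  destruct (Hlip r ltac:(unfold r; lra)) as [q [Hq Hl]].
  set (k := Cmod b + Cmod c + q).
  assert (Hk : 0 <= k).
  { pose proof (Cmod_ge_0 b); pose proof (Cmod_ge_0 c); unfold k; lra. }
  set (d := Rmin (r - Cmod z) ((sigma - Cmod (F z)) / (k + 1))).
  assert (Hd1 : 0 < d).
  { apply Rmin_pos; [unfold r; lra | apply Rdiv_lt_0_compat; lra]. }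
  assert (Hd2 : d <= r - Cmod z) by apply Rmin_l.
  assert (Hd3 : d * (k + 1) <= sigma - Cmod (F z)).
  { replace (sigma - Cmod (F z))
      with ((sigma - Cmod (F z)) / (k + 1) * (k + 1)) by (field; lra).
    apply Rmult_le_compat_r; [lra | apply Rmin_r]. }
  exists d; split; trivial; intros w Hw.
  assert (Hwr : Cmod w <= r).
  { replace w with (z + (w - z))%C by ring.
    eapply Rle_trans; [apply Cmod_triangle|]. lra. }
  split; [unfold disk, r in *; lra|].
  assert (HL : Cmod (linear_part b c (w - z)) <= (Cmod b + Cmod c) * Cmod (w - z)%C).
  { unfold linear_part. eapply Rle_trans; [apply Cmod_triangle|].
    rewrite !Cmod_mult, Cmod_conj; lra. }
  specialize (Hl w z Hwr ltac:(unfold r; lra)).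
  rewrite <- linear_part_minus in HL.
  set (Lz := linear_part b c z) in *. set (Lw := linear_part b c w) in *.
  replace (F w) with (F z + ((F w - Lw - (F z - Lz)) + (Lw - Lz)))%C by ring.
  eapply Rle_lt_trans; [apply Cmod_triangle|].
  pose proof (Cmod_triangle (F w - Lw - (F z - Lz)) (Lw - Lz)) as HT.
  pose proof (Cmod_ge_0 (w - z)%C). unfold k in *. nra.
- apply (connected_of_paths _ 0). intros z [Hz HFz].
  destruct (Hsol (Cmod (F z)) ltac:(split; trivial; apply Cmod_ge_0))
    as [r [Hr Hsolr]].
  destruct (Hexp r Hr) as [q [Hq Hqr]].
  (* The hypothesis on [t] is inside, so that choice yields a function on [R]. *)
  assert (Hlift : forall t, exists y, 0 <= t <= 1 -> Cmod y <= r /\ F y = (t * F z)%C).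
  { intros t. destruct (classic (0 <= t <= 1)) as [Ht|Ht].
    - destruct (Hsolr (t * F z)%C) as [y Hy]; [|now exists y].
      rewrite Cmod_mult, Cmod_R, Rabs_pos_eq by lra.
      pose proof (Cmod_ge_0 (F z)). nra.
    - exists z; tauto. }
  set (g := fun t => proj1_sig (constructive_indefinite_description _ (Hlift t))).
  assert (Hg : forall t, 0 <= t <= 1 -> Cmod (g t) <= r /\ F (g t) = (t * F z)%C).
  { intros t; exact (proj2_sig (constructive_indefinite_description _ (Hlift t))). }
  exists g, (Cmod (F z) / q).
  assert (Hgd : forall t, 0 <= t <= 1 -> disk r0 (g t)).
  { intros t Ht; destruct (Hg t Ht); unfold disk; lra. }
  repeat split.
  + apply Huni; [apply Hgd; lra | apply U0 |].
    rewrite (proj2 (Hg 0 ltac:(lra))), HF0; ring.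
  + apply Huni; [apply Hgd; lra | trivial |].
    rewrite (proj2 (Hg 1 ltac:(lra))); ring.
  + auto.
  + rewrite (proj2 (Hg t ltac:(lra))), Cmod_mult, Cmod_R, Rabs_pos_eq by lra.
    pose proof (Cmod_ge_0 (F z)). nra.
  + intros s t Hs Ht. destruct (Hg s Hs) as [Hs1 Hs2]. destruct (Hg t Ht) as [Ht1 Ht2].
    specialize (Hqr (g s) (g t) Hs1 Ht1). rewrite Hs2, Ht2 in Hqr.
    replace (s * F z - t * F z)%C with (RtoC (s - t) * F z)%C in Hqr
      by (rewrite RtoC_minus; ring).
    rewrite Cmod_mult, Cmod_R in Hqr.
    apply Rmult_le_reg_l with q; trivial.
    replace (q * (Cmod (F z) / q * Rabs (s - t)))
      with (Rabs (s - t) * Cmod (F z)) by (field; lra). trivial.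
- now intros z [Hz _].
- intros z w [Hz _] [Hw _]. now apply Huni.
- intros w; split.
  + intros [z [[_ Hz] <-]]; exact Hz.
  + intros Hw. unfold disk in Hw.
    destruct (Hsol (Cmod w) ltac:(split; trivial; apply Cmod_ge_0)) as [r [Hr Hs]].
    destruct (Hs w (Rle_refl _)) as [z [Hz E]].
    exists z; repeat split; trivial; [unfold disk; lra | now rewrite E].
Qed.

(** * The radius theorem *)

Lemma aligned_of_Arg alpha a :
  (forall k1 k2 n1 n2 : nat, (k1 < alpha)%nat -> (k2 < alpha)%nat ->
     k1 <> k2 -> n1 <> n2 ->
     a n1 k1 <> RtoC 0 -> a n2 k2 <> RtoC 0 ->
     Rabs (Arg (a n1 k1 / a n2 k2)%C) <= PI / 2) ->
  aligned a alpha.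
Proof.
intros H p q Hp Hq Hk Hn. apply Re_mul_conj_nonneg; intros Ha Hb.
now apply H.
Qed.

(** The bound [coef_bound] is used here in its crude form, every coefficient
    being at most [M]: it makes the remainder negligible at the origin before
    anything is known about the linear coefficients. *)
Lemma lambda_0 a alpha F M :
  (2 <= alpha)%nat -> truncations_converge a alpha F -> aligned a alpha ->
  (forall z, disk 1 z -> Cmod (F z) <= M) ->
  F (RtoC 0) = RtoC 0 ->
  lambda F (RtoC 0) = Rabs (Cmod (a 1%nat 0%nat) - Cmod (a 0%nat 1%nat)).
Proof.
intros Ha HF Hal HM HF0.
assert (HM0 : 0 <= M).
{ eapply Rle_trans; [apply Cmod_ge_0 | apply (HM (RtoC 0))].
  unfold disk; rewrite Cmod_0; lra. }
assert (HK : forall p, (fst p < alpha)%nat -> (2 <= degree p)%nat ->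
               Cmod (coef a p) <= M).
{ intros p Hp Hd. pose proof (coef_bound a alpha F M p Ha HF Hal HM Hp Hd) as H.
  pose proof (pow2_ge_0 (Cmod (a 1 0)%nat)).
  pose proof (pow2_ge_0 (Cmod (a 0 1)%nat)).
  rewrite <- (sqrt_pow2 M HM0), <- (sqrt_pow2 _ (Cmod_ge_0 (coef a p))).
  apply sqrt_le_1_alt; lra. }
destruct (partial_0 a F HF0 (remainder_little_o a alpha F M Ha HF HM0 HK HF0))
  as [Hz Hzb].
unfold lambda; now rewrite Hz, Hzb.
Qed.

Theorem theorem3p5 (alpha : nat) (Halpha : (3 <= alpha)%nat)
  (F : C -> C) (A : nat -> C -> C) (a : nat -> nat -> C)
  (HF : polyanalytic_expansion alpha (disk 1) A F)
  (Ha : forall k, (k < alpha)%nat -> forall z, disk 1 z ->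
     @is_pseries C_AbsRing C_NormedModule (fun n => a n k) z (A k z))
  (Harg : forall k1 k2 n1 n2 : nat, (k1 < alpha)%nat -> (k2 < alpha)%nat ->
     k1 <> k2 -> n1 <> n2 ->
     a n1 k1 <> RtoC 0 -> a n2 k2 <> RtoC 0 ->
     Rabs (Arg (a n1 k1 / a n2 k2)%C) <= PI / 2)
  (HF0 : F (RtoC 0) = RtoC 0) (Hlambda : lambda F (RtoC 0) - 1 = 0) :
  (forall M : R, 1 < M -> (forall z, disk 1 z -> Cmod (F z) <= M) ->
     exists r3 : R,
       least_positive_root
         (fun r => 1 + sqrt (M ^ 2 - 1)
            - sqrt (M ^ 2 - 1) / (1 - r) ^ 3 *
              (r * (2 - r) * (1 - r) + 1 + r
               + r ^ (alpha - 1) * ((INR alpha - 2) * r - INR alpha))) r3 /\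
       univalent_on F (disk r3) /\
       contains_schlicht_disk F (disk r3)
         (r3 - sqrt (M ^ 2 - 1) *
            (2 * r3 ^ 2 * (1 - r3 ^ (alpha - 2)) / (1 - r3) + r3 ^ alpha
             + r3 ^ 2 * (1 - r3 ^ alpha) / (1 - r3) ^ 2)))
  /\
  ((forall z, disk 1 z -> Cmod (F z) <= 1) ->
     univalent_on F (disk 1) /\
     (forall w, image F (disk 1) w <-> disk 1 w)).
Proof.
assert (Hal : (2 <= alpha)%nat) by lia.
assert (HT : truncations_converge a alpha F).
{ intros rho Hrho. apply (trunc_uniform alpha F A); trivial; lia. }
pose proof (aligned_of_Arg alpha a Harg) as Hs.
assert (Hbc : forall M, (forall z, disk 1 z -> Cmod (F z) <= M) ->
          Rabs (Cmod (a 1%nat 0%nat) - Cmod (a 0%nat 1%nat)) = 1).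
{ intros M HM. rewrite <- (lambda_0 a alpha F M); trivial; lra. }
clear Hlambda Harg Ha HF A.
set (b := a 1%nat 0%nat) in *; set (c := a 0%nat 1%nat) in *.
assert (Hsq : forall M, (forall z, disk 1 z -> Cmod (F z) <= M) ->
          (Cmod b - Cmod c) ^ 2 = 1).
{ intros M HM. rewrite <- pow2_abs, (Hbc M HM); ring. }
pose proof (Cmod_ge_0 b) as Hb0. pose proof (Cmod_ge_0 c) as Hc0.
split.
- intros M HM1 HM. specialize (Hbc M HM). specialize (Hsq M HM).
  set (K := sqrt (M ^ 2 - 1)).
  assert (HK0 : 0 < K) by (apply sqrt_lt_R0; nra).
  assert (HK : forall p, (fst p < alpha)%nat -> (2 <= degree p)%nat ->
                 Cmod (coef a p) <= K).
  { intros p Hp Hd.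
    pose proof (coef_bound a alpha F M p Hal HT Hs HM Hp Hd) as H.
    fold b c in H. rewrite <- (sqrt_pow2 (Cmod (coef a p))) by apply Cmod_ge_0.
    apply sqrt_le_1_alt. nra. }
  destruct (critical_radius alpha K Hal HK0) as [r3 [Hr3 Hroot]].
  exists r3. split; [now apply least_positive_root_critical|].
  rewrite schlicht_radius_closed by (trivial; lra).
  apply (perturbed_linear_schlicht F b c); trivial; try lra.
  + now apply schlicht_radius_pos.
  + intros r Hr. exists (K * (slope alpha r - 2)). split.
    * pose proof (slope_increasing alpha r r3 ltac:(lia) Hr ltac:(lra)).
      assert (2 <= slope alpha r); [|nra].
      rewrite <- (slope_0 alpha Hal).
      destruct (Rle_lt_or_eq_dec 0 r (proj1 Hr)) as [H0|<-]; [|lra].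
      apply Rlt_le, slope_increasing; lia || lra.
    * intros z w Hz Hw. apply (remainder_lipschitz a alpha F K z w r); trivial; lra.
  + intros rho Hrho.
    destruct (schlicht_radius_approach alpha K r3 rho Hr3 (proj2 Hrho)) as [s [Hs1 Hs2]].
    exists s; split; trivial; intros z Hz.
    pose proof (remainder_growth a alpha F K z s Hal HT ltac:(lra) HK HF0 Hz ltac:(lra)) as H.
    unfold remainder in H; fold b c in H. unfold schlicht_radius in Hs2. lra.
- intros HM. specialize (Hbc 1 HM). specialize (Hsq 1 HM).
  assert (Hdeg : Cmod b * Cmod c = 0 /\ forall p, (fst p < alpha)%nat ->
            (2 <= degree p)%nat -> Cmod (coef a p) <= 0).
  { (* [|b|^2 + |c|^2 = 1 + 2 |b| |c|] leaves no room below [M^2 = 1]. *)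
    assert (H : forall p, (fst p < alpha)%nat -> (2 <= degree p)%nat ->
              2 * (Cmod b * Cmod c) + Cmod (coef a p) ^ 2 <= 0).
    { intros p Hp Hd.
      pose proof (coef_bound a alpha F 1 p Hal HT Hs HM Hp Hd) as H.
      fold b c in H. nra. }
    assert (Hbc0 : 0 <= Cmod b * Cmod c) by now apply Rmult_le_pos.
    split.
    - specialize (H (0, 2)%nat ltac:(simpl; lia) ltac:(unfold degree; simpl; lia)).
      pose proof (pow2_ge_0 (Cmod (coef a (0, 2)%nat))). lra.
    - intros p Hp Hd. specialize (H p Hp Hd). pose proof (Cmod_ge_0 (coef a p)). nra. }
  destruct Hdeg as [Hprod Hzero].
  assert (HFL : forall z, disk 1 z -> F z = linear_part b c z).
  { intros z Hz.
    pose proof (remainder_growth a alpha F 0 z (Cmod z) Hal HT (Rle_refl 0) Hzero HF0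
                  (Rle_refl _) Hz) as H.
    rewrite Rmult_0_l in H. apply Ceq_minus, Cmod_eq_0, Rle_antisym; trivial.
    apply Cmod_ge_0. }
  assert (Hiso : forall z, Cmod (linear_part b c z) = Cmod z).
  { intros z; apply Rle_antisym.
    - unfold linear_part. eapply Rle_trans; [apply Cmod_triangle|].
      rewrite !Cmod_mult, Cmod_conj. pose proof (Cmod_ge_0 z).
      assert (Cmod b + Cmod c = 1) by nra. nra.
    - pose proof (linear_part_expanding b c z) as H. rewrite Hbc in H. lra. }
  split.
  + intros z w Hz Hw E. rewrite !HFL in E by trivial.
    apply Ceq_minus, Cmod_eq_0. rewrite <- Hiso, <- linear_part_minus, E, <- Cmod_0.
    f_equal; ring.
  + intros w; split.
    * intros [z [Hz <-]]. unfold disk in *. now rewrite HFL, Hiso.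
    * intros Hw. destruct (linear_part_inverse b c Hbc) as [Li [HLi _]].
      assert (HLw : disk 1 (Li w)) by (unfold disk; now rewrite <- Hiso, HLi).
      exists (Li w); split; trivial. now rewrite HFL, HLi.
Qed.
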